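(* Let $N:\mathbb N^*\to\mathbb N^*$ be a function with the following property: for every $p\in\mathbb N^*$, every group $G$ and every finite symmetric generating set $S$ of $G$, if there exists a finite subset $A\subset G$ containing $S^{N(p)}$ with $\#(A\cdot A)\le p\,\#A$, then $G$ is virtually nilpotent. Given $\delta,H,D>0$ set $R_0=20(D+2\delta)$, $N_0=N\big([3^{12}e^{490H(D+2\delta)}]+1\big)$ and $\varepsilon_0(\delta,H,D)=R_0/N_0$. Let $(X,d)$ be a $\delta$-hyperbolic space and $\Gamma$ a group acting properly by isometries on $X$ with $\operatorname{diam}(\Gamma\backslash X)\le D$ and $\operatorname{Ent}(X,d)\le H$. Then for every $x\in X$ and every $\varrho\le\varepsilon_0(\delta,H,D)$, the subgroup $\Gamma_\varrho(x)$ is virtually cyclic.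
   Context: $S^k$ denotes the set of products of $k$ elements of $S$; $[t]$ is the integer part. $\Gamma_\varrho(x)$ is the subgroup of $\Gamma$ generated by $\Sigma_\varrho(x)=\{\gamma\in\Gamma^*: d(x,\gamma x)\le\varrho\}$. A $\delta$-hyperbolic space is a geodesic proper metric space all of whose geodesic triangles are $\delta$-thin (in the tripod sense: for a triangle with vertices $x,y,z$, map it onto the tripod with edge lengths the Gromov products $(y|z)_x=\frac12(d(x,y)+d(x,z)-d(y,z))$, isometrically on each side; points with the same image are at distance $\le\delta$). Proper action: $\{\gamma:d(x,\gamma x)\le R\}$ finite. Quotient distance $\bar d(\Gamma x,\Gamma y)=\inf_\gamma d(x,\gamma y)$. $\operatorname{Ent}(X,d)=\liminf_{R\to\infty}\frac1R\ln\#\{\gamma\in\Gamma:d(x,\gamma x)<R\}$. *)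

(* Defs.v *)
From Stdlib Require Import Reals Lra ZArith List.
Open Scope R_scope.

Record Group (G : Type) := mkGroup {
  gmul : G -> G -> G;
  ginv : G -> G;
  gone : G;
  gmul_assoc : forall a b c, gmul a (gmul b c) = gmul (gmul a b) c;
  gmul_1l : forall a, gmul gone a = a;
  gmul_1r : forall a, gmul a gone = a;
  gmul_Vl : forall a, gmul (ginv a) a = gone;
  gmul_Vr : forall a, gmul a (ginv a) = gone
}.
Arguments gmul {G} _ _ _.
Arguments ginv {G} _ _.
Arguments gone {G} _.

Section GroupDefs.
Context {G : Type} (g : Group G).

Inductive gen (S : G -> Prop) : G -> Prop :=
| gen_in : forall x, S x -> gen S x
| gen_one : gen S (gone g)
| gen_mul : forall x y, gen S x -> gen S y -> gen S (gmul g x y)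
| gen_inv : forall x, gen S x -> gen S (ginv g x).

Definition is_subgroup (K : G -> Prop) : Prop :=
  K (gone g) /\ (forall x y, K x -> K y -> K (gmul g x y)) /\
  (forall x, K x -> K (ginv g x)).

Definition finite_index_in (K P : G -> Prop) : Prop :=
  exists l : list G, forall x, P x -> exists h, In h l /\ K (gmul g (ginv g h) x).

Definition commutator (a b : G) : G :=
  gmul g (gmul g (ginv g a) (ginv g b)) (gmul g a b).

Fixpoint lower_central (K : G -> Prop) (i : nat) : G -> Prop :=
  match i with
  | O => K
  | S j => gen (fun c => exists a b, lower_central K j a /\ K b /\ c = commutator a b)
  end.

Definition nilpotent_sub (K : G -> Prop) : Prop :=
  exists n, forall x, lower_central K n x -> x = gone g.

Definition virtually_nilpotent : Prop :=
  exists K, is_subgroup K /\ finite_index_in K (fun _ => True) /\ nilpotent_sub K.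

Fixpoint gpow (a : G) (n : nat) : G :=
  match n with O => gone g | S m => gmul g a (gpow a m) end.

Definition zpow (a : G) (z : Z) : G :=
  match z with
  | Z0 => gone g
  | Zpos p => gpow a (Pos.to_nat p)
  | Zneg p => ginv g (gpow a (Pos.to_nat p))
  end.

Definition cyclic_sub (K : G -> Prop) : Prop :=
  exists c, forall x, K x <-> exists n : Z, x = zpow c n.

Definition virtually_cyclic_sub (P : G -> Prop) : Prop :=
  exists K, is_subgroup K /\ (forall x, K x -> P x) /\
            finite_index_in K P /\ cyclic_sub K.

Definition prod_list (l : list G) : G := fold_right (gmul g) (gone g) l.
Definition Spow (S : list G) (k : nat) (x : G) : Prop :=
  exists l : list G, length l = k /\ (forall s, In s l -> In s S) /\ x = prod_list l.

Definition symmetric_set (S : list G) : Prop :=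
  forall s, In s S -> In (ginv g s) S.

Definition generating_set (S : list G) : Prop :=
  forall x, gen (fun s => In s S) x.

End GroupDefs.

Definition has_card {T : Type} (P : T -> Prop) (n : nat) : Prop :=
  exists l : list T, NoDup l /\ length l = n /\ forall x, In x l <-> P x.

(* Property of N from the statement (Breuillard-Green-Tao type). *)
Definition N_property (N : nat -> nat) : Prop :=
  forall (p : nat), (0 < p)%nat ->
  forall (G : Type) (g : Group G) (S : list G),
    symmetric_set g S -> generating_set g S ->
    (exists (A : list G) (nAA : nat),
        NoDup A /\ (forall x, Spow g S (N p) x -> In x A) /\
        has_card (fun z => exists a b, In a A /\ In b A /\ z = gmul g a b) nAA /\
        (nAA <= p * length A)%nat) ->
    virtually_nilpotent g.

Definition is_metric {X : Type} (d : X -> X -> R) : Prop :=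
  (forall x y, 0 <= d x y) /\ (forall x y, d x y = 0 <-> x = y) /\
  (forall x y, d x y = d y x) /\ (forall x y z, d x z <= d x y + d y z).

Definition geodesic {X : Type} (d : X -> X -> R) (x y : X) (s : R -> X) : Prop :=
  s 0 = x /\ s (d x y) = y /\
  forall a b, 0 <= a <= d x y -> 0 <= b <= d x y -> d (s a) (s b) = Rabs (a - b).

Definition geodesic_space {X : Type} (d : X -> X -> R) : Prop :=
  forall x y, exists s, geodesic d x y s.

(* proper: closed balls are compact (sequential compactness, metric setting) *)
Definition proper_metric {X : Type} (d : X -> X -> R) : Prop :=
  forall (x : X) (r : R) (u : nat -> X), (forall n, d x (u n) <= r) ->
  exists (phi : nat -> nat) (l : X),
    (forall n m, (n < m)%nat -> (phi n < phi m)%nat) /\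
    forall eps, 0 < eps -> exists M, forall n, (M <= n)%nat -> d (u (phi n)) l < eps.

Definition gromov_product {X : Type} (d : X -> X -> R) (x y z : X) : R :=
  (d x y + d x z - d y z) / 2.

(* delta-thin geodesic triangles (tripod sense): two sides issued from a common
   vertex x, towards y and z, are delta-close up to the Gromov product (y|z)_x. *)
Definition thin_triangles {X : Type} (d : X -> X -> R) (delta : R) : Prop :=
  forall x y z (s1 s2 : R -> X), geodesic d x y s1 -> geodesic d x z s2 ->
  forall t, 0 <= t <= gromov_product d x y z -> d (s1 t) (s2 t) <= delta.

Definition hyperbolic_space {X : Type} (d : X -> X -> R) (delta : R) : Prop :=
  is_metric d /\ geodesic_space d /\ proper_metric d /\ thin_triangles d delta.

Definition isometric_action {X G : Type} (d : X -> X -> R) (g : Group G)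
  (act : G -> X -> X) : Prop :=
  (forall x, act (gone g) x = x) /\
  (forall a b x, act (gmul g a b) x = act a (act b x)) /\
  (forall a x y, d (act a x) (act a y) = d x y).

Definition proper_action {X G : Type} (d : X -> X -> R) (act : G -> X -> X) : Prop :=
  forall x r, exists l : list G, forall a, d x (act a x) <= r -> In a l.

(* diam(Gamma \ X) <= D, where the quotient distance is inf_gamma d(x, gamma y);
   "inf <= D" is written as: every lower bound is <= D. *)
Definition quotient_diam_le {X G : Type} (d : X -> X -> R) (act : G -> X -> X)
  (D : R) : Prop :=
  forall x y, forall m, (forall a, m <= d x (act a y)) -> m <= D.

(* Ent(X,d) <= H : liminf_{R->oo} (1/R) ln #{gamma : d(x,gamma x) < R} <= H *)
Definition entropy_le {X G : Type} (d : X -> X -> R) (act : G -> X -> X)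
  (x : X) (H : R) : Prop :=
  forall eps, 0 < eps -> forall R0, exists r n, R0 <= r /\ 0 < r /\
    has_card (fun a => d x (act a x) < r) n /\ ln (INR n) / r <= H + eps.

Definition Sigma {X G : Type} (d : X -> X -> R) (g : Group G) (act : G -> X -> X)
  (rho : R) (x : X) (a : G) : Prop :=
  a <> gone g /\ d x (act a x) <= rho.

Definition Gamma_rho {X G : Type} (d : X -> X -> R) (g : Group G) (act : G -> X -> X)
  (rho : R) (x : X) : G -> Prop :=
  gen g (Sigma d g act rho x).

Definition R0c (delta D : R) : R := 20 * (D + 2 * delta).
Definition N0c (N : nat -> nat) (delta H D : R) : nat :=
  N (S (Z.to_nat (Int_part (3 ^ 12 * exp (490 * H * (D + 2 * delta)))))).
Definition eps0 (N : nat -> nat) (delta H D : R) : R :=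
  R0c delta D / INR (N0c N delta H D).

(* Main.v *)
Require Import Defs.
From Stdlib Require Import Reals List.
From Stdlib Require Import Lra Lia ZArith Classical ClassicalEpsilon.
Open Scope R_scope.

(** Put [a = D + 2 delta]. Recentre a [20a]-separated set of orbit points of [B(x, 40a)] at an
    orbit point minimising the sum of distances to it. Seen from there, every direction
    leaves at least about a quarter of the set outside its cone. The recentred set can
    therefore be attached without backtracking at every orbit point, which gives a tree of
    orbit points with pairwise disjoint shadows; comparing its growth with the entropy
    bounds the cardinality by [3^12 e^(490 H a)].

    If [A] is the set of elements of the subgroup with displacement at most [20a], a
    maximal [20a]-separated subset of [A A] gives translates of [A] covering [A A]. Hence
    the property of [N] makes the subgroup virtually nilpotent.

    A virtually nilpotent group with a uniformly proper action on a hyperbolic space is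
    virtually cyclic. Finite submonoids have bounded order. Going up the lower central
    series of a nilpotent subgroup of finite index, from a finite term [i + 1], either term
    [i] is torsion, hence finite, or it contains an element of infinite order with finitely
    many conjugates. The powers of such an element have finite index in its centraliser. *)

(** * Lists, sums and groups *)

Arguments gmul_assoc {G} _ _ _ _.
Arguments gmul_1l {G} _ _.
Arguments gmul_1r {G} _ _.
Arguments gmul_Vl {G} _ _.
Arguments gmul_Vr {G} _ _.

Definition holds (P : Prop) : bool :=
  if excluded_middle_informative P then true else false.

Lemma holdsP (P : Prop) : holds P = true <-> P.
Proof.
unfold holds; destruct (excluded_middle_informative P); split; auto; discriminate.
Qed.

Lemma in_filter_holds {T} (P : T -> Prop) l t :
  In t (filter (fun s => holds (P s)) l) <-> In t l /\ P t.
Proof. now rewrite filter_In, holdsP. Qed.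

(** Infima need not be attained here, so centres and medians are chosen only up to a slack [eta].
    Completeness is applied to the set of opposites. *)
Lemma near_minimum (S : R -> Prop) (eta : R) :
  0 < eta -> (exists r, S r) -> (forall r, S r -> 0 <= r) ->
  exists r, S r /\ forall r', S r' -> r <= r' + eta.
Proof.
intros He [r0 H0] Hpos.
destruct (completeness (fun y => S (- y))) as [m [Hub Hlub]].
- exists 0. intros y Hy. specialize (Hpos _ Hy). lra.
- exists (- r0). now rewrite Ropp_involutive.
- destruct (classic (exists r, S r /\ r <= - m + eta)) as [[r [Hr Hle]]|Hno].
  + exists r; split; auto. intros r' Hr'.
    assert (- r' <= m) by (apply Hub; now rewrite Ropp_involutive). lra.
  + exfalso. assert (m <= m - eta); [|lra].
    apply Hlub. intros y Hy. destruct (Rle_dec y (m - eta)) as [|Hn]; auto.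
    exfalso; apply Hno. exists (- y). split; auto; lra.
Qed.

(** Maximal families come from a bound on their length: without a longest member there would be
    members of every length. *)
Lemma exists_longest {T} (P : list T -> Prop) (B : nat) :
  (exists l, P l) -> (forall l, P l -> (length l <= B)%nat) ->
  exists l, P l /\ forall l', P l' -> (length l' <= length l)%nat.
Proof.
intros [l0 H0] HB. apply NNPP. intros Hno.
assert (H : forall k, exists l, P l /\ (k <= length l)%nat).
{ induction k as [|k [l [Hl Hk]]]; [exists l0; split; auto; lia|].
  apply NNPP. intros Hk'. apply Hno. exists l. split; auto.
  intros l' Hl'. destruct (Nat.le_gt_cases (length l') (length l)); auto.
  exfalso; apply Hk'. exists l'. split; auto; lia. }
destruct (H (S B)) as [l [Hl Hk]]. specialize (HB l Hl). lia.
Qed.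

(** Turns a list that merely contains the images into an exact enumeration; membership is decided by
    excluded middle. *)
Lemma finite_preimage {T U} (f : T -> U) (l : list U) :
  (forall s t, f s = f t -> s = t) ->
  forall Q : T -> Prop, (forall t, Q t -> In (f t) l) ->
  exists l', NoDup l' /\ forall t, In t l' <-> Q t.
Proof.
intros Hinj. induction l as [|u l IH]; intros Q HQ.
- exists nil. split; [constructor|]. intros t; split; [easy|apply HQ].
- destruct (IH (fun t => Q t /\ f t <> u)) as [l' [Hnd Hl']].
  { intros t [Ht Hn]. destruct (HQ t Ht); [congruence|auto]. }
  destruct (classic (exists t, Q t /\ f t = u)) as [[t0 [Ht0 Hu]]|Hno].
  + exists (t0 :: l'). split.
    * constructor; auto. rewrite Hl'. tauto.
    * intros t. simpl. rewrite Hl'. split.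
      -- intros [<-|[H _]]; auto.
      -- intros H. destruct (classic (f t = u)); [left; apply Hinj; congruence|tauto].
  + exists l'. split; auto. intros t. rewrite Hl'. split; [tauto|].
    intros H; split; auto. intros Hu. apply Hno; eauto.
Qed.

Lemma finite_subset {T} (l : list T) (Q : T -> Prop) :
  (forall t, Q t -> In t l) -> exists l', NoDup l' /\ forall t, In t l' <-> Q t.
Proof. intros H. apply (finite_preimage (fun t => t) l); auto. Qed.

Lemma NoDup_map_on {T U} (f : T -> U) (l : list T) :
  NoDup l -> (forall s t, In s l -> In t l -> f s = f t -> s = t) ->
  NoDup (map f l).
Proof.
induction 1 as [|t l Hn Hnd IH]; intros Hinj; simpl; constructor.
- intros H. apply in_map_iff in H. destruct H as [s [Hs Hin]].
  apply Hn. rewrite <- (Hinj s t); simpl; auto.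
- apply IH. intros; apply Hinj; simpl; auto.
Qed.

Lemma NoDup_flat_map_disjoint {T U} (f : T -> list U) (l : list T) :
  NoDup l -> (forall t, In t l -> NoDup (f t)) ->
  (forall s t z, In s l -> In t l -> In z (f s) -> In z (f t) -> s = t) ->
  NoDup (flat_map f l).
Proof.
induction 1 as [|t l Hn Hnd IH]; intros Hf Hd; simpl; [constructor|].
apply NoDup_app; [apply Hf; simpl; auto| |].
- apply IH; [intros; apply Hf; simpl; auto|].
  intros s t' z Hs Ht'; apply Hd; simpl; auto.
- intros z Hz Hz'. apply in_flat_map in Hz'. destruct Hz' as [s [Hs Hzs]].
  apply Hn. rewrite (Hd t s z); simpl; auto.
Qed.

Lemma length_flat_map_ge {T U} (f : T -> list U) (l : list T) (q : nat) :
  (forall t, In t l -> (q <= length (f t))%nat) ->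
  (length l * q <= length (flat_map f l))%nat.
Proof.
induction l as [|t l IH]; intros H; simpl; [lia|].
rewrite length_app. specialize (H t (or_introl eq_refl)) as H1.
assert (length l * q <= length (flat_map f l))%nat by (apply IH; intros; apply H; simpl; auto).
lia.
Qed.

Lemma length_flat_map_const {T U} (f : T -> list U) (l : list T) (q : nat) :
  (forall t, length (f t) = q) -> length (flat_map f l) = (length l * q)%nat.
Proof.
intros H. induction l as [|t l IH]; simpl; auto. now rewrite length_app, H, IH.
Qed.

Lemma NoDup_constant_length {T} (l : list T) :
  NoDup l -> (forall s t, In s l -> In t l -> s = t) -> (length l <= 1)%nat.
Proof.
intros Hnd H. destruct l as [|s [|t l]]; simpl; auto.
exfalso. inversion Hnd as [|? ? Hn]; subst. apply Hn.
rewrite (H s t); simpl; auto.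
Qed.

Lemma length_filter3 {T} (P Q V : T -> Prop) (l : list T) :
  (forall t, P t \/ Q t \/ V t) ->
  (length l <= length (filter (fun t => holds (P t)) l)
             + length (filter (fun t => holds (Q t)) l)
             + length (filter (fun t => holds (V t)) l))%nat.
Proof.
intros H. induction l as [|t l IH]; simpl; [lia|].
assert (H' : holds (P t) = true \/ holds (Q t) = true \/ holds (V t) = true)
  by (rewrite !holdsP; auto).
destruct (holds (P t)), (holds (Q t)), (holds (V t)); simpl; try lia.
Qed.

(** The induction peels off the top window, whose points satisfy the pairwise condition because it
    has width [h]. *)
Lemma window_pigeonhole {T} (phi : T -> R) (h : R) (q K : nat) : 0 < h ->
  forall l, NoDup l ->
  (forall t, In t l -> 0 <= phi t < INR K * h) ->
  (forall l', NoDup l' -> incl l' l ->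
     (forall s t, In s l' -> In t l' -> phi s <= phi t + h) -> (length l' <= q)%nat) ->
  (length l <= K * q)%nat.
Proof.
intros Hh. induction K as [|K IH]; intros l Hnd Hr Hw.
- destruct l as [|t l]; simpl; auto.
  specialize (Hr t (or_introl eq_refl)). simpl in Hr. lra.
- set (lo := filter (fun t => holds (phi t < INR K * h)) l).
  set (hi := filter (fun t => negb (holds (phi t < INR K * h))) l).
  assert (Hlen : length l = (length lo + length hi)%nat).
  { symmetry. apply filter_length. }
  assert (Hlo : (length lo <= K * q)%nat).
  { apply IH.
    - now apply NoDup_filter.
    - intros t Ht. apply in_filter_holds in Ht. destruct Ht as [Ht H].
      specialize (Hr t Ht). lra.
    - intros l' Hl' Hin. apply Hw; auto. intros t Ht. apply Hin in Ht.
      now apply in_filter_holds in Ht. }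
  assert (Hhi : (length hi <= q)%nat).
  { assert (Hin : forall t, In t hi -> In t l /\ INR K * h <= phi t).
    { intros t Ht. apply filter_In in Ht. destruct Ht as [Ht H]. split; auto.
      apply Rnot_lt_le. intros H'. apply holdsP in H'. now rewrite H' in H. }
    apply Hw.
    - now apply NoDup_filter.
    - intros t Ht. now apply Hin.
    - intros s t Hs Ht. destruct (Hin s Hs) as [Hs' Hs2], (Hin t Ht) as [Ht' Ht2].
      specialize (Hr s Hs'). rewrite S_INR in Hr. lra. }
  simpl. lia.
Qed.

(** If the last value lies outside [[- sigma, sigma]], the one before it is on the same side of 0,
    so the change of sign persists on the shorter range. *)
Lemma discrete_ivt (s : nat -> R) (sigma : R) (n : nat) :
  0 <= sigma -> (forall i, (i < n)%nat -> s i - sigma <= s (S i) <= s i + sigma) ->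
  (s 0%nat <= 0 <= s n) \/ (s n <= 0 <= s 0%nat) ->
  exists i, (i <= n)%nat /\ - sigma <= s i <= sigma.
Proof.
intros Hs. induction n as [|n IH]; intros Hstep Hsign.
- exists 0%nat. split; auto. lra.
- specialize (Hstep n (Nat.lt_succ_diag_r n)) as Hn.
  destruct (Rle_dec (- sigma) (s (S n))) as [H1|H1];
  [destruct (Rle_dec (s (S n)) sigma) as [H2|H2]; [exists (S n); split; auto|]|].
  + destruct IH as [i [Hi H]]; [intros; apply Hstep; lia|lra|].
    exists i; split; auto.
  + destruct IH as [i [Hi H]]; [intros; apply Hstep; lia|lra|].
    exists i; split; auto.
Qed.

Definition sumR {T} (f : T -> R) (l : list T) : R :=
  fold_right (fun t s => f t + s) 0 l.

Lemma sumR_nonneg {T} (f : T -> R) l : (forall t, 0 <= f t) -> 0 <= sumR f l.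
Proof.
intros H. induction l as [|t l IH]; simpl; [lra|]. specialize (H t). lra.
Qed.

Lemma sumR_upper {T} (f : T -> R) (v : R) l :
  (forall t, In t l -> f t <= v) -> sumR f l <= v * INR (length l).
Proof.
induction l as [|t l IH]; intros H; [simpl; lra|].
change (length (t :: l)) with (S (length l)). rewrite S_INR. simpl.
specialize (H t (or_introl eq_refl)) as H1.
assert (sumR f l <= v * INR (length l)) by (apply IH; intros; apply H; simpl; auto).
lra.
Qed.

Lemma sumR_lower2 {T} (f f' : T -> R) (v : R) l :
  (forall t, In t l -> v <= f t + f' t) -> v * INR (length l) <= sumR f l + sumR f' l.
Proof.
induction l as [|t l IH]; intros H; [simpl; lra|].
change (length (t :: l)) with (S (length l)). rewrite S_INR. simpl.
specialize (H t (or_introl eq_refl)) as H1.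
assert (v * INR (length l) <= sumR f l + sumR f' l) by (apply IH; intros; apply H; simpl; auto).
lra.
Qed.

Lemma sumR_two_rates {T} (f f' : T -> R) (P : T -> Prop) (al be : R) l :
  (forall t, P t -> f' t <= f t - al) -> (forall t, f' t <= f t + be) ->
  let m := INR (length (filter (fun t => holds (P t)) l)) in
  sumR f' l <= sumR f l - al * m + be * (INR (length l) - m).
Proof.
intros HP H. induction l as [|t l IH]; [simpl; lra|].
change (length (t :: l)) with (S (length l)). rewrite S_INR.
cbv zeta in *. simpl filter. unfold sumR in *. simpl fold_right.
destruct (holds (P t)) eqn:E.
- apply (proj1 (holdsP _)) in E. specialize (HP t E).
  rewrite length_cons, S_INR. lra.
- specialize (H t). lra.
Qed.

Lemma nat_floor (t : R) : 0 <= t -> exists k : nat, INR k <= t < INR k + 1.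
Proof.
intros Ht. destruct (archimed t) as [H1 H2].
assert (0 < up t)%Z by (apply lt_IZR; lra).
exists (Z.to_nat (up t - 1)). rewrite INR_IZR_INZ, Z2Nat.id by lia.
rewrite minus_IZR. lra.
Qed.

Section GroupFacts.
Context {G : Type} (g : Group G).

Lemma gcancel_l a b c : gmul g a b = gmul g a c -> b = c.
Proof.
intros H. rewrite <- (gmul_1l g b), <- (gmul_1l g c), <- (gmul_Vl g a), <- !gmul_assoc.
now rewrite H.
Qed.

Lemma gcancel_r a b c : gmul g b a = gmul g c a -> b = c.
Proof.
intros H. rewrite <- (gmul_1r g b), <- (gmul_1r g c), <- (gmul_Vr g a), !gmul_assoc.
now rewrite H.
Qed.

Lemma gmulKl a b : gmul g (ginv g a) (gmul g a b) = b.
Proof. now rewrite gmul_assoc, gmul_Vl, gmul_1l. Qed.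

Lemma gmulKlV a b : gmul g a (gmul g (ginv g a) b) = b.
Proof. now rewrite gmul_assoc, gmul_Vr, gmul_1l. Qed.

Lemma ginv_unique a b : gmul g a b = gone g -> b = ginv g a.
Proof. intros H. apply (gcancel_l a). now rewrite H, gmul_Vr. Qed.

Lemma ginv_mul a b : ginv g (gmul g a b) = gmul g (ginv g b) (ginv g a).
Proof.
symmetry; apply ginv_unique.
now rewrite <- gmul_assoc, gmulKlV, gmul_Vr.
Qed.

Lemma ginv_inv a : ginv g (ginv g a) = a.
Proof. symmetry; apply ginv_unique, gmul_Vl. Qed.

Lemma ginv_one : ginv g (gone g) = gone g.
Proof. symmetry; apply ginv_unique, gmul_1l. Qed.

Definition commutes (a b : G) : Prop := gmul g a b = gmul g b a.

Lemma commutes_mul a b c : commutes a c -> commutes b c -> commutes (gmul g a b) c.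
Proof.
unfold commutes. intros Ha Hb. now rewrite <- gmul_assoc, Hb, gmul_assoc, Ha, gmul_assoc.
Qed.

Lemma commutes_inv a c : commutes a c -> commutes (ginv g a) c.
Proof.
unfold commutes. intros Ha. apply (gcancel_l a).
now rewrite gmulKlV, gmul_assoc, Ha, <- gmul_assoc, gmul_Vr, gmul_1r.
Qed.

Lemma commutes_pow a c n : commutes a c -> commutes (gpow g a n) c.
Proof.
intros Ha. induction n as [|n IH]; simpl.
- unfold commutes. now rewrite gmul_1l, gmul_1r.
- now apply commutes_mul.
Qed.

Lemma commutes_sym a b : commutes a b -> commutes b a.
Proof. now unfold commutes. Qed.

Lemma gpow_add a n m : gpow g a (n + m) = gmul g (gpow g a n) (gpow g a m).
Proof.
induction n as [|n IH]; simpl; [now rewrite gmul_1l|]. now rewrite IH, gmul_assoc.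
Qed.

Lemma gpow_mul_one a n m : gpow g a n = gone g -> gpow g a (n * m) = gone g.
Proof.
intros H. induction m as [|m IH]; [now rewrite Nat.mul_0_r|].
now rewrite Nat.mul_succ_r, gpow_add, IH, H, gmul_1l.
Qed.

Lemma gpow_mod a n e : (0 < n)%nat -> gpow g a n = gone g ->
  gpow g a e = gpow g a (e mod n).
Proof.
intros Hn H. rewrite (Nat.div_mod_eq e n) at 1.
now rewrite gpow_add, gpow_mul_one, gmul_1l.
Qed.

Definition infinite_order (h : G) : Prop :=
  forall n, (0 < n)%nat -> gpow g h n <> gone g.

Lemma gpow_inj h : infinite_order h -> forall n m, gpow g h n = gpow g h m -> n = m.
Proof.
intros Hh.
assert (H : forall n k, gpow g h n = gpow g h (n + k) -> k = 0%nat).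
{ intros n k. rewrite gpow_add, <- (gmul_1r g (gpow g h n)) at 1.
  intros E. apply gcancel_l in E. destruct k; auto.
  exfalso. apply (Hh (S k)); [lia|auto]. }
intros n m E. destruct (Nat.le_ge_cases n m) as [L|L].
- specialize (H n (m - n)%nat). replace (n + (m - n))%nat with m in H by lia.
  specialize (H E). lia.
- specialize (H m (n - m)%nat). replace (m + (n - m))%nat with n in H by lia.
  specialize (H (eq_sym E)). lia.
Qed.

Lemma zpow_of_nat a n : zpow g a (Z.of_nat n) = gpow g a n.
Proof.
destruct n as [|n]; auto.
change (gpow g a (Pos.to_nat (Pos.of_succ_nat n)) = gpow g a (S n)).
now rewrite SuccNat2Pos.id_succ.
Qed.

Lemma zpow_opp_of_nat a n : zpow g a (- Z.of_nat n) = ginv g (gpow g a n).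
Proof.
destruct n as [|n]; [simpl; now rewrite ginv_one|].
change (ginv g (gpow g a (Pos.to_nat (Pos.of_succ_nat n))) = ginv g (gpow g a (S n))).
now rewrite SuccNat2Pos.id_succ.
Qed.

Lemma gpow_div a n m :
  exists z, gmul g (ginv g (gpow g a n)) (gpow g a m) = zpow g a z.
Proof.
destruct (Nat.le_ge_cases n m) as [L|L].
- exists (Z.of_nat (m - n)). rewrite zpow_of_nat.
  replace m with (n + (m - n))%nat at 1 by lia. now rewrite gpow_add, gmulKl.
- exists (- Z.of_nat (n - m))%Z. rewrite zpow_opp_of_nat.
  replace n with (m + (n - m))%nat at 1 by lia.
  now rewrite gpow_add, ginv_mul, <- gmul_assoc, gmul_Vl, gmul_1r.
Qed.

End GroupFacts.

(** * Hyperbolic geometry *)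

Section HyperbolicGeometry.
Context {X : Type} (d : X -> X -> R) (delta : R).
Context (hX : hyperbolic_space d delta).

Lemma metric_nonneg x y : 0 <= d x y.
Proof. apply hX. Qed.

Lemma metric_self x : d x x = 0.
Proof. now apply hX. Qed.

Lemma metric_sym x y : d x y = d y x.
Proof. apply hX. Qed.

Lemma metric_tri x y z : d x z <= d x y + d y z.
Proof. apply hX. Qed.

Lemma gromov_product_bounds w x y :
  0 <= gromov_product d w x y <= d w x /\ gromov_product d w x y <= d w y.
Proof.
unfold gromov_product.
pose proof (metric_tri x w y). pose proof (metric_tri w x y). pose proof (metric_tri w y x).
rewrite (metric_sym x w), (metric_sym y x) in *. lra.
Qed.

Lemma point_towards x y t : 0 <= t <= d x y ->
  exists m, d x m = t /\ d m y = d x y - t.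
Proof.
intros Ht. destruct hX as [_ [Hg _]]. destruct (Hg x y) as [s [H0 [H1 Hs]]].
pose proof (metric_nonneg x y).
pose proof (Hs 0 t) as D0. pose proof (Hs t (d x y)) as D1.
rewrite H0, Rabs_left1 in D0 by lra. rewrite H1, Rabs_left1 in D1 by lra.
exists (s t). lra.
Qed.

(** With [t] the smaller of the two products, the points at distance [t] from [w] towards [x] and
    towards [z] are both [delta]-close to the one towards [y], hence [2 * delta]-close to each
    other. The factor 1/2 in the product leaves a loss of [delta]. *)
Lemma four_point w x y z :
  gromov_product d w x y - delta <= gromov_product d w x z \/
  gromov_product d w y z - delta <= gromov_product d w x z.
Proof.
assert (H : forall t, 0 <= t -> t <= gromov_product d w x y ->
  t <= gromov_product d w y z -> t - delta <= gromov_product d w x z).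
{ intros t H0 Hxy Hyz. destruct hX as [_ [Hg [_ Hthin]]].
  destruct (Hg w x) as [s1 G1], (Hg w y) as [s2 G2], (Hg w z) as [s3 G3].
  pose proof (Hthin _ _ _ _ _ G1 G2 t (conj H0 Hxy)) as T1.
  pose proof (Hthin _ _ _ _ _ G2 G3 t (conj H0 Hyz)) as T2.
  pose proof (gromov_product_bounds w x y). pose proof (gromov_product_bounds w y z).
  destruct G1 as [_ [E1 D1]], G3 as [_ [E3 D3]].
  specialize (D1 t (d w x)). specialize (D3 t (d w z)).
  rewrite E1, Rabs_left1 in D1 by lra. rewrite E3, Rabs_left1 in D3 by lra.
  pose proof (metric_tri (s1 t) (s2 t) (s3 t)). pose proof (metric_tri x (s1 t) z).
  pose proof (metric_tri (s1 t) (s3 t) z). rewrite (metric_sym x (s1 t)) in *.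
  unfold gromov_product. lra. }
pose proof (gromov_product_bounds w x y). pose proof (gromov_product_bounds w y z).
destruct (Rle_dec (gromov_product d w x y) (gromov_product d w y z)).
- left. apply H; lra.
- right. apply H; lra.
Qed.

(** The four-point condition without base point, in terms of the three sums of opposite
    distances. *)
Lemma four_point_sum x y z w :
  d x z + d y w <= d x y + d z w + 2 * delta \/
  d x z + d y w <= d y z + d x w + 2 * delta.
Proof.
destruct (four_point w x y z) as [H|H]; unfold gromov_product in H;
rewrite !(metric_sym w) in H; [left|right]; lra.
Qed.

(** As [m] lies between [c] and [u], its product with [u] at [c] is [s]; the four-point inequality
    then makes its product with [e] at least [s - delta]. *)
Lemma dist_from_point_towards c m u e s :
  d c m = s -> d m u = d c u - s -> s <= gromov_product d c u e ->
  d m e <= d c e - s + 2 * delta.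
Proof.
intros H1 H2 H3. destruct (four_point c m u e) as [H|H];
unfold gromov_product in *; lra.
Qed.

(* Both points are near a geodesic from [u] to [v], so they are as close as their
   distances to [u] are. *)
Lemma dist_near_geodesic u v y z e :
  gromov_product d y u v <= e -> gromov_product d z u v <= e ->
  d y z <= d u y - d u z + 2 * e + 2 * delta \/
  d y z <= d u z - d u y + 2 * e + 2 * delta.
Proof.
intros Hy Hz. pose proof (four_point u y v z) as H.
unfold gromov_product in *.
rewrite !(metric_sym _ u), !(metric_sym _ v), ?(metric_sym v u) in *.
rewrite ?(metric_sym z v), ?(metric_sym y v) in *. lra.
Qed.

(** * Isometries that move both ends of a long segment by little *)

Section FellowTravel.
Context (u v q : X) (W : R) (hdelta : 0 < delta).
Context (hmu : d u q = d u v / 2) (hmv : d v q = d u v / 2).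
Context (hlong : 10 * W + 100 * delta < d u q).

(** Signed coordinate along the segment from [u] to [v], with origin at the midpoint [q]. *)
Definition axial_shift (y : X) : R := (d u y - d v y) / 2.

Definition tame (a : X -> X) : Prop :=
  (forall y z, d (a y) (a z) = d y z) /\ d u (a u) <= W /\ d v (a v) <= W.

Lemma shift_bound a w : tame a -> d u (a u) <= w -> d v (a v) <= w ->
  - w <= axial_shift (a q) <= w.
Proof.
intros [Hi _] Hu Hv. unfold axial_shift.
pose proof (metric_tri u (a u) (a q)). pose proof (metric_tri v (a v) (a q)).
pose proof (metric_tri (a u) u (a q)). pose proof (metric_tri (a v) v (a q)).
rewrite (metric_sym (a u) u), (metric_sym (a v) v), !Hi in *. lra.
Qed.

(** [a q] is midway between [a u] and [a v], so their product there is 0. The ends move little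
    compared with the length of the segment, so replacing [a u] by [u] and [a v] by [v] costs only
    [delta] each. *)
Lemma image_near_geodesic a : tame a -> gromov_product d (a q) u v <= 2 * delta.
Proof.
intros [Hi [Hu Hv]].
assert (H0 : gromov_product d (a q) (a u) (a v) = 0).
{ unfold gromov_product. rewrite !Hi, !(metric_sym q). lra. }
pose proof (four_point (a q) (a u) u (a v)) as H1.
pose proof (four_point (a q) u v (a v)) as H2.
assert (delta < gromov_product d (a q) (a u) u - delta).
{ unfold gromov_product. pose proof (metric_tri (a q) u (a u)).
  rewrite (metric_sym (a u) u), (metric_sym (a q) (a u)), Hi in *.
  pose proof (metric_nonneg u (a u)). lra. }
assert (2 * delta < gromov_product d (a q) v (a v) - delta).
{ unfold gromov_product. pose proof (metric_tri (a q) v (a v)).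
  rewrite (metric_sym (a q) (a v)), Hi in *.
  pose proof (metric_nonneg v (a v)). lra. }
lra.
Qed.

(** Both [q] and [a q] are near a geodesic from [u] to [v], so their distance is the difference of
    their distances to [u] up to [6 * delta]; replacing that difference by the shift costs
    [2 * delta] more. *)
Lemma displacement_le_shift a r : tame a -> - r <= axial_shift (a q) <= r ->
  d q (a q) <= r + 8 * delta.
Proof.
intros Ha Hs. pose proof (image_near_geodesic a Ha) as He.
assert (H0 : gromov_product d q u v <= 2 * delta).
{ unfold gromov_product. rewrite !(metric_sym q). lra. }
assert (2 * gromov_product d (a q) u v = d u (a q) + d v (a q) - d u v).
{ unfold gromov_product. rewrite !(metric_sym (a q)). lra. }
pose proof (gromov_product_bounds (a q) u v).
unfold axial_shift in Hs.
destruct (dist_near_geodesic u v q (a q) (2 * delta) H0 He); lra.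
Qed.

Lemma shift_comp a b : tame a -> tame b -> tame (fun y => a (b y)) ->
  axial_shift (a q) + axial_shift (b q) - 2 * delta <= axial_shift (a (b q))
    <= axial_shift (a q) + axial_shift (b q) + 2 * delta.
Proof.
intros Ha Hb Hab.
assert (Hdq : d q (b q) <= W + 8 * delta).
{ apply displacement_le_shift; auto. apply shift_bound; auto; apply Hb. }
(* Among [p], [a p], [a q], [a (b q)], the sum that pairs [p] with [a p] is by far the smallest, so
   the other two agree up to [2 * delta]. As [a] is an isometry, this compares how the distance to
   [p] changes from [q] to [b q] and from [a q] to [a (b q)]. *)
assert (H : forall p, d p q = d u v / 2 -> d p (a p) <= W -> d p (b p) <= W ->
  - 2 * delta <= (d p (a (b q)) - d p (a q)) - (d p (b q) - d p q) <= 2 * delta).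
{ intros p Hp Hpa Hpb. destruct Ha as [Hia _], Hb as [Hib _].
  pose proof (four_point_sum p (a p) (a (b q)) (a q)) as H1.
  pose proof (four_point_sum p (a p) (a q) (a (b q))) as H2.
  rewrite (metric_sym (a (b q)) (a q)) in H1.
  rewrite !Hia in *.
  pose proof (metric_tri (a p) p (a (b q))). pose proof (metric_tri (a p) p (a q)).
  pose proof (metric_tri (b p) p (b q)). pose proof (metric_nonneg p (a p)).
  rewrite (metric_sym (a p) p), (metric_sym (b p) p), !Hia, !Hib in *.
  lra. }
pose proof (H u hmu (proj1 (proj2 Ha)) (proj1 (proj2 Hb))).
pose proof (H v hmv (proj2 (proj2 Ha)) (proj2 (proj2 Hb))).
unfold axial_shift. lra.
Qed.

End FellowTravel.
End HyperbolicGeometry.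

(** * Virtually nilpotent uniformly proper groups *)

Lemma choice_function {T U} (Q : T -> U -> Prop) :
  (forall t, exists u, Q t u) -> exists f, forall t, Q t (f t).
Proof.
intros H. exists (fun t => proj1_sig (constructive_indefinite_description _ (H t))).
intros t. apply proj2_sig.
Qed.

Lemma list_bounded {T} (f : T -> R) (l : list T) :
  exists M, 0 <= M /\ forall t, In t l -> f t <= M.
Proof.
induction l as [|t l [M [H0 HM]]]; [exists 0; split; [lra|easy]|].
exists (Rmax M (f t)). split; [apply Rle_trans with M; auto; apply Rmax_l|].
intros s [<-|Hs]; [apply Rmax_r|].
apply Rle_trans with M; [auto|apply Rmax_l].
Qed.

Lemma finite_image_representatives {T U} (f : T -> U) (l : list U) :
  forall K : T -> Prop, (forall k, K k -> In (f k) l) ->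
  exists l', forall k, K k -> exists k', In k' l' /\ K k' /\ f k = f k'.
Proof.
induction l as [|u l IH]; intros K HK; [exists nil; intros k Hk; destruct (HK k Hk)|].
destruct (IH (fun k => K k /\ f k <> u)) as [l' Hl'].
{ intros k [Hk Hn]. destruct (HK k Hk); [congruence|auto]. }
destruct (classic (exists k, K k /\ f k = u)) as [[k0 [Hk0 Hu]]|Hno].
- exists (k0 :: l'). intros k Hk. destruct (classic (f k = u)) as [E|E].
  + exists k0. simpl. repeat split; auto. congruence.
  + destruct (Hl' k (conj Hk E)) as [k' [H1 [[H2 _] H3]]]. exists k'. simpl; auto.
- exists l'. intros k Hk. destruct (Hl' k) as [k' [H1 [[H2 _] H3]]]; [split; auto|].
  + intros E. apply Hno; eauto.
  + exists k'; auto.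
Qed.

Lemma NoDup_powers {G} (g : Group G) h n : infinite_order g h ->
  NoDup (map (gpow g h) (seq 0 n)).
Proof.
intros Hh. apply NoDup_map_on; [apply seq_NoDup|].
intros s t _ _. now apply gpow_inj.
Qed.

Lemma ginv_commutator {G} (g : Group G) a f :
  gmul g (ginv g a) (gmul g f a) = gmul g f (ginv g (commutator g a f)).
Proof.
unfold commutator. rewrite !ginv_mul, !ginv_inv, <- !gmul_assoc.
now rewrite (gmulKlV g f).
Qed.

Section Action.
Context {X G : Type} (d : X -> X -> R) (delta : R).
Context (hX : hyperbolic_space d delta) (hdelta : 0 < delta).
Context (g : Group G) (act : G -> X -> X) (hact : isometric_action d g act).

Lemma act_one x : act (gone g) x = x.
Proof. apply hact. Qed.

Lemma act_mul a b x : act (gmul g a b) x = act a (act b x).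
Proof. apply hact. Qed.

Lemma act_isometry a x y : d (act a x) (act a y) = d x y.
Proof. apply hact. Qed.

Lemma act_inv_l a x : act (ginv g a) (act a x) = x.
Proof. now rewrite <- act_mul, gmul_Vl, act_one. Qed.

Lemma dist_act a b x y : d (act a x) (act b y) = d x (act (gmul g (ginv g a) b) y).
Proof. now rewrite act_mul, <- (act_isometry (ginv g a)), act_inv_l. Qed.

Lemma displacement_mul a b x :
  d x (act (gmul g a b) x) <= d x (act a x) + d x (act b x).
Proof.
rewrite act_mul, <- (act_isometry a x (act b x)). apply (metric_tri d delta hX).
Qed.

Lemma displacement_inv a x : d x (act (ginv g a) x) = d x (act a x).
Proof.
rewrite <- (act_isometry a), <- act_mul, gmul_Vr, act_one. apply (metric_sym d delta hX).
Qed.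

Lemma displacement_pow a n x : d x (act (gpow g a n) x) <= INR n * d x (act a x).
Proof.
induction n as [|n IH].
- simpl. rewrite act_one, (metric_self d delta hX). lra.
- rewrite S_INR. simpl gpow. pose proof (displacement_mul a (gpow g a n) x). lra.
Qed.

(** The bound is uniform in the point [q]. Unlike cocompactness, this property passes to subgroups,
    where it will be used. *)
Definition uniformly_proper : Prop :=
  forall C, exists B, forall q l, NoDup l ->
    (forall a, In a l -> d q (act a q) <= C) -> (length l <= B)%nat.

Context (hUP : uniformly_proper) (x0 : X).

(* A finite submonoid has a point that all its elements move by at most [6 * delta],
   namely an almost optimal centre of an orbit. *)
Lemma finite_submonoid_bound :
  exists B, forall l, NoDup l -> In (gone g) l ->
    (forall a b, In a l -> In b l -> In (gmul g a b) l) -> (length l <= B)%nat.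
Proof.
destruct (hUP (6 * delta)) as [B HB]. exists B. intros l Hnd H1 Hmul.
destruct (near_minimum (fun r => exists p, forall e, In e l -> d p (act e x0) <= r) delta)
  as [r [[p Hp] Hmin]]; auto.
{ destruct (list_bounded (fun e => d x0 (act e x0)) l) as [M [_ HM]]. eauto. }
{ intros r [p Hp]. specialize (Hp _ H1). pose proof (metric_nonneg d delta hX p (act (gone g) x0)).
  lra. }
apply (HB p l Hnd). intros f Hf.
(* Left translation by [f] is injective on a finite set, hence onto; so [f p] is as good a centre as
   [p]. *)
assert (Hsurj : forall e, In e l -> exists e', In e' l /\ gmul g f e' = e).
{ assert (Hincl : incl l (map (gmul g f) l)).
  { apply NoDup_length_incl.
    - apply NoDup_map_on; auto. intros s t _ _. apply gcancel_l.
    - now rewrite length_map.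
    - intros z Hz. apply in_map_iff in Hz. destruct Hz as [e [<- He]]. auto. }
  intros e He. apply Hincl, in_map_iff in He. firstorder. }
set (q := act f p).
assert (Hq : forall e, In e l -> d q (act e x0) <= r).
{ intros e He. destruct (Hsurj e He) as [e' [He' <-]].
  unfold q. rewrite act_mul, act_isometry. auto. }
pose proof (metric_nonneg d delta hX p q).
destruct (point_towards d delta hX p q (d p q / 2)) as [m [Hm1 Hm2]]; [lra|].
(* The midpoint of [p] and [q] has radius at most [r - d p q / 2 + 2 * delta]; optimality up to
   [delta] forces [d p q <= 6 * delta]. *)
assert (Hm : r <= r - d p q / 2 + 2 * delta + delta); [|lra].
apply Hmin. exists m. intros e He. specialize (Hp e He). specialize (Hq e He).
(* The products at [p] and at [q] add up to [d p q], so one of them is at least half of it. *)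
destruct (Rle_dec (d p q / 2) (gromov_product d p q (act e x0))) as [L|L].
- pose proof (dist_from_point_towards d delta hX p m q _ _ Hm1 Hm2 L). lra.
- assert (L' : d p q / 2 <= gromov_product d q p (act e x0)).
  { unfold gromov_product in *. rewrite (metric_sym d delta hX q p). lra. }
  rewrite (metric_sym d delta hX) in Hm1, Hm2.
  pose proof (dist_from_point_towards d delta hX q m p (act e x0) (d p q / 2)) as H'.
  rewrite (metric_sym d delta hX q p) in H'. lra.
Qed.

Section Centraliser.
Context (h : G) (hh : infinite_order g h).

(* On the middle of a long geodesic from [x0] to [h^n x0], the signed shift is a
   quasimorphism of the centraliser of [h], unbounded on powers of [h]; so every element
   has a translate by a power of [h] that moves the midpoint by a bounded amount. *)
Lemma centraliser_separated_bound :
  exists B, forall l, NoDup l -> (forall k, In k l -> commutes g k h) ->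
    (forall k k', In k l -> In k' l ->
       (exists n m, gmul g (gpow g h n) k = gmul g (gpow g h m) k') -> k = k') ->
    (length l <= B)%nat.
Proof.
set (norm := fun a => d x0 (act a x0)).
assert (Hn0 : forall a, 0 <= norm a) by (intros; apply (metric_nonneg d delta hX)).
assert (Hninv : forall a, norm (ginv g a) = norm a) by (intros; apply displacement_inv).
assert (Hnmul : forall a b, norm (gmul g a b) <= norm a + norm b)
  by (intros; apply displacement_mul).
(* [B] depends on [h] but not on the list; [kap], [J], [W] and the segment are adapted to the
   list. *)
destruct (hUP (norm h + 10 * delta)) as [B HB]. exists B. intros l Hnd Hcomm Hsep.
destruct (list_bounded norm l) as [kap [Hkap0 Hkap]].
destruct (hUP (kap + 14 * delta)) as [J HJ].
(* [W] dominates the displacement of every product [h^i h^(-j) k] used below, with [i <= 2 * J] and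
   [j <= J]. *)
set (W := 4 * INR J * norm h + kap + norm h).
pose proof (pos_INR J) as HJ0.
assert (HJh : 0 <= INR J * norm h) by (apply Rmult_le_pos; auto).
assert (Hn : exists n, 20 * W + 200 * delta < d x0 (act (gpow g h n) x0)).
{ destruct (hUP (20 * W + 200 * delta)) as [B2 HB2]. apply NNPP. intros Hno.
  specialize (HB2 x0 (map (gpow g h) (seq 0 (S B2)))).
  rewrite length_map, length_seq in HB2.
  assert (S B2 <= B2)%nat; [apply HB2|lia].
  - now apply NoDup_powers.
  - intros a Ha. apply in_map_iff in Ha. destruct Ha as [n [<- _]].
    apply Rnot_lt_le. intros Hlt. apply Hno. eauto. }
destruct Hn as [n Hlong]. set (v := act (gpow g h n) x0) in *.
destruct (point_towards d delta hX x0 v (d x0 v / 2)) as [q [Hqu Hqv]].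
{ pose proof (metric_nonneg d delta hX x0 v). lra. }
assert (Hqv' : d v q = d x0 v / 2) by (rewrite (metric_sym d delta hX); lra).
assert (Hfar : 10 * W + 100 * delta < d x0 q) by lra.
(* An element commuting with [h] moves [v = h^n x0] exactly as far as [x0]; this is why the
   centraliser acts tamely on the segment. *)
assert (Hv : forall a, commutes g a h -> d v (act a v) = norm a).
{ intros a Ha. unfold v, norm. rewrite <- act_mul.
  rewrite <- (commutes_pow g h a n) by now apply commutes_sym.
  now rewrite act_mul, act_isometry. }
assert (Htame : forall a, commutes g a h -> norm a <= W -> tame d x0 v W (act a)).
{ intros a Ha Hw. repeat split; [apply act_isometry|exact Hw|now rewrite Hv]. }
set (sh := fun a => axial_shift d x0 v (act a q)).
assert (Hshb : forall a, commutes g a h -> norm a <= W -> - norm a <= sh a <= norm a).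
{ intros a Ha Hw. apply (shift_bound d delta hX x0 v q W Hqu Hqv'); auto.
  - unfold norm; lra.
  - rewrite Hv; auto; lra. }
assert (Hshd : forall a r, commutes g a h -> norm a <= W -> - r <= sh a <= r ->
  d q (act a q) <= r + 8 * delta).
{ intros a r Ha Hw. apply (displacement_le_shift d delta hX x0 v q W); auto. }
assert (Hshm : forall a b, commutes g a h -> commutes g b h -> norm a <= W -> norm b <= W ->
  norm (gmul g a b) <= W ->
  sh a + sh b - 2 * delta <= sh (gmul g a b) <= sh a + sh b + 2 * delta).
{ intros a b Ha Hb Hwa Hwb Hw. unfold sh. rewrite act_mul.
  apply (shift_comp d delta hX x0 v q W); auto.
  pose proof (Htame _ (commutes_mul g a b h Ha Hb) Hw) as [H1 [H2 H3]].
  rewrite act_mul in H2, H3. repeat split; auto.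
  intros; now rewrite !act_isometry. }
assert (Hpow : forall i, norm (gpow g h i) <= INR i * norm h)
  by (intros; apply displacement_pow).
assert (Hpowc : forall i, commutes g (gpow g h i) h)
  by (intros; now apply commutes_pow).
assert (Hmulti : forall i j, (i <= j)%nat -> INR i * norm h <= INR j * norm h).
{ intros i j Hij. apply Rmult_le_compat_r; auto. now apply le_INR. }
(* Otherwise the [J + 1] distinct powers [h^0, ..., h^J] would all move [q] by at most
   [kap + 14 * delta]. The excess over [kap] makes the sign of the shift of [h^j] survive
   multiplication by [k]. *)
assert (Hj : exists j, (j <= J)%nat /\
  (kap + 6 * delta < sh (gpow g h j) \/ sh (gpow g h j) < - (kap + 6 * delta))).
{ apply NNPP. intros Hno.
  specialize (HJ q (map (gpow g h) (seq 0 (S J)))).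
  rewrite length_map, length_seq in HJ.
  assert (S J <= J)%nat; [apply HJ|lia].
  - now apply NoDup_powers.
  - intros a Ha. apply in_map_iff in Ha. destruct Ha as [i [<- Hi]].
    apply in_seq in Hi. replace (kap + 14 * delta) with ((kap + 6 * delta) + 8 * delta) by ring.
    apply Hshd; auto.
    + pose proof (Hpow i). assert (INR i * norm h <= INR J * norm h) by (apply Hmulti; lia).
      unfold W. specialize (Hn0 h). lra.
    + split; apply Rnot_lt_le; intros Hlt; apply Hno; exists i; (split; [lia|auto]). }
destruct Hj as [j [HjJ Hjbig]].
set (m := ginv g (gpow g h j)).
assert (Hmc : commutes g m h) by now apply commutes_inv.
assert (Hmn : norm m <= INR J * norm h).
{ unfold m. rewrite Hninv.
  pose proof (Hpow j). pose proof (Hmulti j J HjJ). lra. }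
assert (Hpj : norm (gpow g h j) <= INR J * norm h).
{ pose proof (Hpow j). pose proof (Hmulti j J HjJ). lra. }
assert (Hone : norm (gone g) = 0).
{ unfold norm. rewrite act_one. apply (metric_self d delta hX). }
assert (Hshone : sh (gone g) = 0).
{ unfold sh, axial_shift. rewrite act_one. lra. }
assert (Hshinv : - sh (gpow g h j) - 2 * delta <= sh m <= - sh (gpow g h j) + 2 * delta).
{ specialize (Hn0 h).
  pose proof (Hshm (gpow g h j) m (Hpowc j) Hmc) as H.
  replace (gmul g (gpow g h j) m) with (gone g) in H by (symmetry; apply gmul_Vr).
  rewrite Hone, Hshone in H. unfold W in H. lra. }
assert (Hbase : forall i k, (i <= 2 * J)%nat -> In k l ->
  norm (gmul g (gpow g h i) (gmul g m k)) <= W).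
{ intros i k Hi Hk.
  pose proof (Hnmul (gpow g h i) (gmul g m k)) as D1.
  pose proof (Hnmul m k) as D2.
  pose proof (Hkap k Hk). pose proof (Hpow i). pose proof (Hmulti i (2 * J)%nat Hi).
  rewrite mult_INR in *. simpl (INR 2) in *.
  unfold W. specialize (Hn0 h). lra. }
(* From [i = 0] to [i = 2 * j] the product runs from [h^(-j) k] to [h^j k], whose shifts have
   opposite signs, in steps of at most [norm h + 2 * delta]. Where the shift is that small, [q]
   moves by at most [8 * delta] more. *)
assert (Hsol : forall k, exists i, In k l ->
  d q (act (gmul g (gpow g h i) (gmul g m k)) q) <= norm h + 10 * delta).
(* Outside [l] the exponent 0 is a dummy that makes the choice function total. *)
{ intros k. destruct (classic (In k l)) as [Hk|Hk]; [|exists 0%nat; tauto].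
  specialize (Hn0 h) as Hh0. specialize (Hkap k Hk) as Hkk. specialize (Hcomm k Hk) as Hck.
  assert (Hc : forall i, commutes g (gmul g (gpow g h i) (gmul g m k)) h)
    by (intros; repeat apply commutes_mul; auto).
  destruct (discrete_ivt (fun i => sh (gmul g (gpow g h i) (gmul g m k)))
              (norm h + 2 * delta) (2 * j)) as [i [Hi Hs]].
  - lra.
  - intros i Hi. simpl gpow. rewrite <- (gmul_assoc g h).
    assert (Hb1 := Hbase i k ltac:(lia) Hk). assert (Hb2 := Hbase (S i) k ltac:(lia) Hk).
    simpl gpow in Hb2. rewrite <- (gmul_assoc g h) in Hb2.
    assert (HhW : norm h <= W) by (unfold W; lra).
    pose proof (Hshm h _ (eq_refl : commutes g h h) (Hc i) HhW Hb1 Hb2).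
    pose proof (Hshb h eq_refl HhW). lra.
  - change (gpow g h 0) with (gone g). rewrite (gmul_1l g (gmul g m k)).
    replace (2 * j)%nat with (j + j)%nat by lia.
    replace (gmul g (gpow g h (j + j)) (gmul g m k)) with (gmul g (gpow g h j) k).
    2:{ rewrite gpow_add, <- !gmul_assoc. unfold m. now rewrite gmulKlV. }
    pose proof (Hnmul (gpow g h j) k).
    pose proof (Hnmul m k).
    assert (norm (gpow g h j) <= W /\ norm m <= W /\ norm k <= W) as [W1 [W2 W3]]
      by (unfold W; lra).
    pose proof (Hshm (gpow g h j) k (Hpowc j) Hck W1 W3) as S1.
    pose proof (Hshm m k Hmc Hck W2 W3) as S2.
    pose proof (Hshb k Hck W3).
    unfold W in S1, S2. lra.
  - exists i. intros _. replace (norm h + 10 * delta) with ((norm h + 2 * delta) + 8 * delta) by ring.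
    apply Hshd; auto. apply Hbase; auto; lia. }
destruct (choice_function _ Hsol) as [f Hf].
rewrite <- (length_map (fun k => gmul g (gpow g h (f k)) (gmul g m k)) l).
apply (HB q).
- apply NoDup_map_on; auto. intros k k' Hk Hk' E. apply Hsep; auto.
  exists (f k), (f k'). apply (gcancel_l g m).
  assert (Hmp : forall i, gmul g m (gpow g h i) = gmul g (gpow g h i) m).
  { intros i. symmetry. apply (commutes_pow g h m i). now apply commutes_sym. }
  now rewrite !gmul_assoc, !Hmp, <- !gmul_assoc.
- intros a Ha. apply in_map_iff in Ha. destruct Ha as [k [<- Hk]]. auto.
Qed.

(** A longest list of elements in distinct cosets of the powers of [h] exists by the preceding
    bound, and it meets every coset. *)
Lemma centraliser_cover :
  exists l, forall k, commutes g k h ->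
    exists e z, In e l /\ k = gmul g e (zpow g h z).
Proof.
destruct centraliser_separated_bound as [B HB].
destruct (exists_longest (fun l => NoDup l /\ (forall k, In k l -> commutes g k h) /\
    (forall k k', In k l -> In k' l ->
       (exists n m, gmul g (gpow g h n) k = gmul g (gpow g h m) k') -> k = k')) B)
  as [l [[Hnd [Hc Hs]] Hmax]].
{ exists nil. repeat split; [constructor|easy|easy]. }
{ intros l [H1 [H2 H3]]. auto. }
exists l. intros k Hk.
assert (Hrel : exists k', In k' l /\
  exists n m, gmul g (gpow g h n) k = gmul g (gpow g h m) k').
{ apply NNPP. intros Hno. specialize (Hmax (k :: l)). simpl in Hmax.
  assert (S (length l) <= length l)%nat; [apply Hmax; clear Hmax|lia].
  repeat split.
  - constructor; auto. intros Hin. apply Hno. exists k. split; auto.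
    now exists 0%nat, 0%nat.
  - intros k' [<-|H]; auto.
  - intros k1 k2 [<-|H1] [<-|H2] [n [m E]]; auto.
    + exfalso; apply Hno; eauto 6.
    + exfalso; apply Hno; eauto 6.
    + apply Hs; eauto. }
destruct Hrel as [k' [Hin [n [m E]]]].
destruct (gpow_div g h n m) as [z Hz].
exists k', z. split; auto.
rewrite <- Hz.
apply (gcancel_l g (gpow g h n)). rewrite E.
assert (Hkn : forall i, gmul g k' (gpow g h i) = gmul g (gpow g h i) k').
{ intros i. symmetry. apply commutes_pow, commutes_sym; auto. }
rewrite (gmul_assoc g k'). rewrite (commutes_sym g _ _ (commutes_inv g _ k' (eq_sym (Hkn n)))).
now rewrite <- gmul_assoc, gmulKlV, Hkn.
Qed.

End Centraliser.

(** * Climbing the lower central series *)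

(** Take a longest list [l] inside [K] that contains [M] and is closed under products. For [a] in
    [L] and [f] in [l], [f a = a f'] where [f'] is [f] times an element of [M], so the products of
    powers of [a] with [l] form another such list. Maximality puts [a] in [l]. *)
Lemma finite_term_of_torsion (K L M : G -> Prop) (lm : list G) :
  is_subgroup g K -> (forall a, L a -> K a) -> (forall a, M a -> K a) ->
  is_subgroup g M -> (forall a, M a -> In a lm) ->
  (forall a b, L a -> K b -> M (commutator g a b)) ->
  (forall a, L a -> ~ infinite_order g a) ->
  exists l, forall a, L a -> In a l.
Proof.
intros HK HLK HMK HM Hlm Hcom Htor.
destruct finite_submonoid_bound as [B HB].
destruct (exists_longest (fun l => NoDup l /\ (forall m, M m -> In m l) /\
   (forall a, In a l -> K a) /\
   (forall a b, In a l -> In b l -> In (gmul g a b) l)) B)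
  as [l [[Hnd [HMl [HlK Hmul]]] Hmax]].
{ destruct (finite_subset lm M Hlm) as [l [Hnd Hl]]. exists l.
  repeat split; auto; intros a; rewrite ?Hl; auto.
  intros b. rewrite !Hl. apply HM. }
{ intros l [H1 [H2 [_ H3]]]. apply HB; auto. apply H2, HM. }
exists l. intros a Ha.
assert (Hn : exists n, (0 < n)%nat /\ gpow g a n = gone g).
{ apply NNPP. intros Hno. apply (Htor a Ha). intros n Hn E. apply Hno; eauto. }
destruct Hn as [n [Hn0 Hn]].
assert (Hconj : forall f, In f l -> exists f', In f' l /\ gmul g f a = gmul g a f').
{ intros f Hf. exists (gmul g f (ginv g (commutator g a f))). split.
  - apply Hmul; auto. apply HMl, HM, Hcom; auto.
  - now rewrite <- ginv_commutator, gmulKlV. }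
assert (Hconje : forall e f, In f l ->
  exists f', In f' l /\ gmul g f (gpow g a e) = gmul g (gpow g a e) f').
{ induction e as [|e IH]; intros f Hf.
  - exists f. simpl. now rewrite gmul_1l, gmul_1r.
  - destruct (Hconj f Hf) as [f1 [Hf1 E1]]. destruct (IH f1 Hf1) as [f2 [Hf2 E2]].
    exists f2. split; auto. simpl. now rewrite gmul_assoc, E1, <- !gmul_assoc, E2. }
destruct (finite_subset
  (flat_map (fun e => map (gmul g (gpow g a e)) l) (seq 0 n))
  (fun x => exists e f, In f l /\ x = gmul g (gpow g a e) f)) as [l' [Hnd' Hl']].
{ intros x [e [f [Hf ->]]]. apply in_flat_map. exists (e mod n)%nat. split.
  - apply in_seq. pose proof (Nat.mod_upper_bound e n). lia.
  - rewrite (gpow_mod g a n e) by auto. now apply in_map. }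
assert (Hpow : forall e, K (gpow g a e)).
{ induction e; simpl; [apply HK|apply HK; auto]. }
assert (Hincl : incl l l').
{ intros f Hf. apply Hl'. exists 0%nat, f. split; auto. simpl. now rewrite gmul_1l. }
assert (Hincl' : incl l' l).
{ apply NoDup_length_incl; auto. apply Hmax. repeat split; auto.
  - intros x Hx. apply Hl' in Hx. destruct Hx as [e [f [Hf ->]]]. apply HK; auto.
  - intros x y Hx Hy. apply Hl' in Hx, Hy.
    destruct Hx as [e [f [Hf ->]]], Hy as [e' [f' [Hf' ->]]]. apply Hl'.
    destruct (Hconje e' f Hf) as [f2 [Hf2 E2]].
    exists (e + e')%nat, (gmul g f2 f'). split; auto.
    now rewrite gpow_add, <- !gmul_assoc, (gmul_assoc g f), E2, !gmul_assoc. }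
apply Hincl', Hl'. exists 1%nat, (gone g). split.
- apply HMl, HM.
- simpl. now rewrite !gmul_1r.
Qed.

Definition cyclic_cover (K : G -> Prop) : Prop :=
  exists c l, forall k, K k -> exists e z, In e l /\ k = gmul g e (zpow g c z).

Lemma lower_central_sub (K : G -> Prop) : is_subgroup g K ->
  forall i x, lower_central g K i x -> K x.
Proof.
intros [H1 [Hm Hi]]. induction i as [|i IH]; intros x; simpl; auto.
induction 1 as [x [a [b [Ha [Hb ->]]]]| | |]; auto.
unfold commutator. auto 7.
Qed.

Lemma lower_central_subgroup (K : G -> Prop) i : is_subgroup g K ->
  is_subgroup g (lower_central g K i).
Proof.
intros HK. destruct i; auto. repeat split.
- apply gen_one.
- intros; now apply gen_mul.
- intros; now apply gen_inv.
Qed.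

Lemma nilpotent_cyclic_cover (K : G -> Prop) :
  is_subgroup g K -> nilpotent_sub g K -> cyclic_cover K.
Proof.
intros HK [n Hn].
assert (H : forall i lm, (forall x, lower_central g K i x -> In x lm) -> cyclic_cover K).
{ induction i as [|i IH]; intros lm Hlm.
  - exists (gone g), lm. intros k Hk. exists k, 0%Z. split; [now apply Hlm|].
    simpl. now rewrite gmul_1r.
  - destruct (classic (exists h, lower_central g K i h /\ infinite_order g h))
      as [[h [Hh Hinf]]|Hno].
    + destruct (centraliser_cover h Hinf) as [le Hle].
      (* Conjugates of [h] under [K] are [h] times a commutator from the finite term [i + 1], so
         there are finitely many; elements giving the same conjugate differ by the centraliser of
         [h]. *)
      destruct (finite_image_representatives
        (fun k => gmul g k (gmul g h (ginv g k))) (map (gmul g h) lm) K) as [lr Hlr].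
      { intros k Hk.
        replace (gmul g k (gmul g h (ginv g k)))
          with (gmul g h (commutator g h (ginv g k))).
        - apply in_map, Hlm. apply gen_in. exists h, (ginv g k).
          repeat split; auto. now apply HK.
        - unfold commutator. rewrite ginv_inv, <- !gmul_assoc.
          now rewrite gmulKlV. }
      exists h, (flat_map (fun k => map (gmul g k) le) lr). intros k Hk.
      destruct (Hlr k Hk) as [k' [Hk' [_ E]]].
      destruct (Hle (gmul g (ginv g k') k)) as [e [z [He Ez]]].
      { unfold commutes. apply (gcancel_l g k'), (gcancel_r g (ginv g k)).
        rewrite <- !gmul_assoc, !gmulKlV, E, gmul_Vr, gmul_1r. reflexivity. }
      exists (gmul g k' e), z. split.
      * apply in_flat_map. exists k'. split; auto. now apply in_map.
      * now rewrite <- gmul_assoc, <- Ez, gmulKlV.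
    + destruct (finite_term_of_torsion K (lower_central g K i) (lower_central g K (S i)) lm)
        as [l Hl]; auto.
      * now apply lower_central_sub.
      * now apply lower_central_sub.
      * now apply lower_central_subgroup.
      * intros a b Ha Hb. apply gen_in. eauto.
      * intros a Ha Hinf. apply Hno; eauto.
      * now apply (IH l). }
(* The climb starts at term [n], which is trivial. *)
apply (H n (gone g :: nil)). intros x Hx. left. symmetry. now apply Hn.
Qed.

Lemma virtually_nilpotent_cyclic_cover :
  virtually_nilpotent g -> cyclic_cover (fun _ => True).
Proof.
intros [K [HK [[l Hl] Hnil]]].
destruct (nilpotent_cyclic_cover K HK Hnil) as [c [l' Hl']].
exists c, (flat_map (fun k => map (gmul g k) l') l). intros x Hx.
destruct (Hl x Hx) as [k [Hk HKx]]. destruct (Hl' _ HKx) as [e [z [He E]]].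
exists (gmul g k e), z. split.
- apply in_flat_map. exists k. split; auto. now apply in_map.
- now rewrite <- gmul_assoc, <- E, gmulKlV.
Qed.

End Action.

(** * Packing of orbits and entropy *)

Section Branching.
Context {X T : Type} (d : X -> X -> R) (delta a L : R).
Context (hX : hyperbolic_space d delta) (hda : 2 * delta <= a) (hdelta : 0 < delta).
Context (o : X) (pt : T -> X) (child : T -> list T) (q : nat).
Context (child_NoDup : forall y, NoDup (child y)).
Context (child_many : forall y, (q <= length (child y))%nat).
Context (child_dist : forall y w, In w (child y) -> 10 * a < d (pt y) (pt w) <= L).
Context (child_away : forall y w, In w (child y) ->
  gromov_product d (pt y) o (pt w) < 4 * a).
Context (child_sep : forall y w w', In w (child y) -> In w' (child y) -> w <> w' ->
  20 * a < d (pt w) (pt w')).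
Context (child_level : forall y w w', In w (child y) -> In w' (child y) ->
  d o (pt w) <= d o (pt w') + 10 * a).

Fixpoint descendants (n : nat) (y : T) : list T :=
  match n with
  | O => y :: nil
  | S m => flat_map (descendants m) (child y)
  end.

(** At the child [w] the product of [o] and [y] exceeds [6 * a], so that of [y] and [z] is at most
    [4 * a + 2 * delta]. Hence [z] lies in the direction of [w] as seen from [y], and that direction
    leads away from [o]. The bound does not worsen with depth. *)
Lemma descendants_shadow n : forall y z, In z (descendants n y) ->
  gromov_product d (pt y) o (pt z) <= 4 * a + delta.
Proof.
induction n as [|n IH]; intros y z Hz; simpl in Hz.
- destruct Hz as [<-|[]].
  pose proof (gromov_product_bounds d delta hX (pt y) o (pt y)).
  rewrite (metric_self d delta hX) in *. lra.
- apply in_flat_map in Hz. destruct Hz as [w [Hw Hz]]. apply IH in Hz.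
  pose proof (child_dist y w Hw). pose proof (child_away y w Hw).
  pose proof (four_point d delta hX (pt w) o (pt y) (pt z)) as F1.
  pose proof (four_point d delta hX (pt y) o (pt z) (pt w)) as F2.
  unfold gromov_product in *.
  rewrite (metric_sym d delta hX (pt w) (pt y)), (metric_sym d delta hX (pt z) (pt w)),
    (metric_sym d delta hX (pt w) o), (metric_sym d delta hX (pt y) o) in *. lra.
Qed.

(** A common descendant puts both children near one geodesic from [o], at levels differing by at
    most [10 * a]; their distance is then at most [18 * a + 4 * delta <= 20 * a], against the
    separation. *)
Lemma descendants_disjoint n y w w' z : In w (child y) -> In w' (child y) ->
  In z (descendants n w) -> In z (descendants n w') -> w = w'.
Proof.
intros Hw Hw' Hz Hz'. apply NNPP. intros Hne.
pose proof (child_sep y w w' Hw Hw' Hne).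
apply descendants_shadow in Hz, Hz'.
pose proof (child_level y w w' Hw Hw'). pose proof (child_level y w' w Hw' Hw).
destruct (dist_near_geodesic d delta hX o (pt z) (pt w) (pt w') _ Hz Hz'); lra.
Qed.

Lemma descendants_NoDup n y : NoDup (descendants n y).
Proof.
revert y. induction n as [|n IH]; intros y; simpl.
- repeat constructor. easy.
- apply NoDup_flat_map_disjoint; auto. intros s t z. apply descendants_disjoint.
Qed.

Lemma descendants_many n y : (q ^ n <= length (descendants n y))%nat.
Proof.
revert y. induction n as [|n IH]; intros y; simpl; auto.
pose proof (length_flat_map_ge (descendants n) (child y) (q ^ n) (fun t _ => IH t)).
specialize (child_many y). nia.
Qed.

Lemma descendants_dist n : forall y z, In z (descendants n y) ->
  d (pt y) (pt z) <= INR n * L.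
Proof.
induction n as [|n IH]; intros y z Hz.
- destruct Hz as [<-|[]]. rewrite (metric_self d delta hX). simpl. lra.
- simpl in Hz. apply in_flat_map in Hz. destruct Hz as [w [Hw Hz]]. apply IH in Hz.
  pose proof (child_dist y w Hw). pose proof (metric_tri d delta hX (pt y) (pt w) (pt z)).
  rewrite S_INR. lra.
Qed.

End Branching.

(** * Medians, children and the packing bound *)

Section Packing.
Context {X G : Type} (d : X -> X -> R) (delta D H : R).
Context (hX : hyperbolic_space d delta) (hdelta : 0 < delta) (hD : 0 < D) (hH : 0 < H).
Context (g : Group G) (act : G -> X -> X) (hact : isometric_action d g act).
Context (hdiam : quotient_diam_le d act D) (x : X).

Let a := D + 2 * delta.
Let apos : 0 < a.
Proof. unfold a; lra. Qed.

Lemma orbit_dense y : exists c, d y (act c x) <= D + delta.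
Proof.
apply NNPP. intros Hno. assert (D + delta <= D); [|lra].
apply (hdiam y x). intros c. apply Rnot_lt_le. intros Hlt. apply Hno.
exists c. lra.
Qed.

Lemma orbit_median (E : list G) : exists c, forall c',
  sumR (fun e => d (act c x) (act e x)) E <= sumR (fun e => d (act c' x) (act e x)) E + a.
Proof.
destruct (near_minimum (fun r => exists c, r = sumR (fun e => d (act c x) (act e x)) E) a)
  as [r [[c ->] Hmin]]; auto.
- exists (sumR (fun e => d (act (gone g) x) (act e x)) E). eauto.
- intros r [c ->]. apply sumR_nonneg. intros; apply (metric_nonneg d delta hX).
- exists c. intros c'. apply Hmin. eauto.
Qed.

Section Median.
Context (E : list G) (c : G).
Context (hmed : forall c', sumR (fun e => d (act c x) (act e x)) E
  <= sumR (fun e => d (act c' x) (act e x)) E + a).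

(* Moving the median by [4 * a] towards [u] brings the points of the cone closer by
   [2 * a] and the others away by at most [6 * a]. *)
Lemma median_cone u :
  8 * INR (length (filter (fun e =>
        holds (4 * a <= gromov_product d (act c x) u (act e x))) E))
    <= 6 * INR (length E) + 1.
Proof.
set (P := fun e => 4 * a <= gromov_product d (act c x) u (act e x)).
destruct (Rlt_dec (d (act c x) u) (4 * a)) as [Hu|Hu].
- assert (Hnil : filter (fun e => holds (P e)) E = nil).
  { destruct (filter (fun e => holds (P e)) E) as [|e l] eqn:El; auto. exfalso.
    assert (He : In e (filter (fun e => holds (P e)) E)) by (rewrite El; simpl; auto).
    apply in_filter_holds in He. destruct He as [_ He]. unfold P in He.
    pose proof (gromov_product_bounds d delta hX (act c x) u (act e x)). lra. }
  unfold P in Hnil. rewrite Hnil. simpl. pose proof (pos_INR (length E)). lra.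
- destruct (point_towards d delta hX (act c x) u (4 * a)) as [m [Hm1 Hm2]]; [lra|].
  (* Passing to an orbit point costs [D + delta]: the gain in the cone is still
     [4 * a - 2 * delta - (D + delta) >= 2 * a], and the loss elsewhere is at most
     [4 * a + D + delta <= 6 * a]. *)
  destruct (orbit_dense m) as [c' Hc'].
  pose proof (sumR_two_rates (fun e => d (act c x) (act e x))
    (fun e => d (act c' x) (act e x)) P (2 * a) (6 * a) E) as Hsum.
  cbv zeta in Hsum. specialize (hmed c').
  assert (Hle : forall e, d (act c' x) (act e x) <= d m (act e x) + (D + delta)).
  { intros e. pose proof (metric_tri d delta hX (act c' x) m (act e x)).
    rewrite (metric_sym d delta hX (act c' x) m) in *. lra. }
  assert (Ha : D + 3 * delta <= 2 * a) by (unfold a; lra).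
  lapply Hsum; clear Hsum; [intros Hsum; lapply Hsum; clear Hsum; [intros Hsum|]|].
  + set (m' := INR (length (filter (fun e => holds (P e)) E))) in *.
    change (8 * m' <= 6 * INR (length E) + 1).
    apply Rmult_le_reg_l with a; auto. lra.
  + intros e. specialize (Hle e).
    pose proof (metric_tri d delta hX m (act c x) (act e x)).
    rewrite (metric_sym d delta hX m (act c x)) in *. lra.
  + intros e He. specialize (Hle e).
    pose proof (dist_from_point_towards d delta hX _ _ _ _ _ Hm1 Hm2 He). lra.
Qed.

(** Comparing the median with [x] itself bounds its mean distance to [E] by [41 * a], so it is
    within [81 * a] of [x]. *)
Lemma median_radius : (forall e, In e E -> d x (act e x) <= 40 * a) ->
  forall e, In e E -> d (act c x) (act e x) <= 121 * a.
Proof.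
intros HE e He.
specialize (hmed (gone g)). rewrite (act_one d g act hact) in hmed.
pose proof (sumR_upper (fun e => d x (act e x)) (40 * a) E HE) as H1.
pose proof (sumR_lower2 (fun e => d (act c x) (act e x)) (fun e => d x (act e x))
  (d (act c x) x) E) as H2.
assert (Hlen : 1 <= INR (length E)).
{ destruct E as [|e' l]; [easy|]. rewrite length_cons, S_INR. pose proof (pos_INR (length l)). lra. }
lapply H2; clear H2; [intros H2|].
- assert (d (act c x) x <= 81 * a).
  { apply Rmult_le_reg_r with (INR (length E)); [lra|].
    assert (a <= a * INR (length E)) by (rewrite <- (Rmult_1_r a) at 1; apply Rmult_le_compat_l; lra).
    lra. }
  pose proof (metric_tri d delta hX (act c x) x (act e x)). specialize (HE e He). lra.
- intros e' _. pose proof (metric_tri d delta hX (act c x) (act e' x) x).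
  rewrite (metric_sym d delta hX x (act e' x)). lra.
Qed.

End Median.

(** [E] is translated so that its median lands on [y]. Removing the cone towards [x] and the at most
    one point within [10 * a] of the median leaves more than [13 * q] points; one of 13 level
    windows of width [10 * a] then keeps more than [q]. *)
Lemma separated_children (E : list G) (q : nat) : NoDup E ->
  (forall e, In e E -> d x (act e x) <= 40 * a) ->
  (forall e e', In e E -> In e' E -> e <> e' -> 20 * a < d (act e x) (act e' x)) ->
  (52 * q + 8 < length E)%nat ->
  forall y, exists l, NoDup l /\ (S q <= length l)%nat /\
    (forall w, In w l -> 10 * a < d (act y x) (act w x) <= 121 * a /\
       gromov_product d (act y x) x (act w x) < 4 * a) /\
    (forall w w', In w l -> In w' l ->
       (w <> w' -> 20 * a < d (act w x) (act w' x)) /\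
       d x (act w x) <= d x (act w' x) + 10 * a).
Proof.
intros Hnd HE Hsep Hlen y.
destruct (orbit_median E) as [c Hc].
pose proof (median_radius E c Hc HE) as Hrad.
set (t := gmul g y (ginv g c)).
assert (Htc : act t (act c x) = act y x).
{ unfold t. now rewrite (act_mul d g act hact), (act_inv_l d g act hact). }
set (u := act (ginv g t) x).
assert (Htu : act t u = x).
{ unfold u. rewrite <- (act_mul d g act hact), gmul_Vr. apply (act_one d g act hact). }
set (o := act c x) in *.
set (P := fun e => gromov_product d o u (act e x) < 4 * a /\ 10 * a < d o (act e x)).
set (F := filter (fun e => holds (P e)) E).
assert (HF : (13 * q < length F)%nat).
{ pose proof (length_filter3 P (fun e => 4 * a <= gromov_product d o u (act e x))
    (fun e => d o (act e x) <= 10 * a) E) as H3. fold F in H3. cbv beta in H3.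
  pose proof (median_cone E c Hc u) as H4. fold o in H4.
  assert (Hone : (length (filter (fun e => holds (d o (act e x) <= 10 * a)%R) E) <= 1)%nat).
  { apply NoDup_constant_length; [now apply NoDup_filter|].
    intros s s' Hs Hs'. apply (in_filter_holds (fun e => d o (act e x) <= 10 * a)) in Hs, Hs'.
    apply NNPP. intros Hne.
    pose proof (Hsep s s' (proj1 Hs) (proj1 Hs') Hne).
    pose proof (metric_tri d delta hX (act s x) o (act s' x)).
    rewrite (metric_sym d delta hX (act s x) o) in *. lra. }
  lapply H3; clear H3; [intros H3|].
  - set (n1 := length (filter (fun e => holds (4 * a <= gromov_product d o u (act e x))) E)) in *.
    assert (8 * n1 <= 6 * length E + 1)%nat.
    { apply INR_le. rewrite plus_INR, !mult_INR. simpl (INR 1).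
      replace (INR 8) with 8 by (simpl; ring). replace (INR 6) with 6 by (simpl; ring). lra. }
    lia.
  - intros e. unfold P.
    destruct (Rlt_dec (gromov_product d o u (act e x)) (4 * a));
    destruct (Rlt_dec (10 * a) (d o (act e x))); auto; right; [right|left|left]; lra. }
assert (Hgp : forall e, gromov_product d o u (act e x)
    = (d (act y x) x + d o (act e x) - d x (act (gmul g t e) x)) / 2).
{ intros e. unfold gromov_product. rewrite (act_mul d g act hact).
  rewrite <- (act_isometry d g act hact t o u), <- (act_isometry d g act hact t u).
  now rewrite Htc, Htu. }
assert (Hdist : forall e, d (act y x) (act (gmul g t e) x) = d o (act e x)).
{ intros e. now rewrite (act_mul d g act hact), <- Htc, (act_isometry d g act hact). }
assert (Hin : forall e, In e F -> In e E /\ P e) by (intros e; apply in_filter_holds).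
(* On [F], [phi] exceeds [10 * a - 8 * a] by the cone condition and is at most [121 * a], so 13
   windows suffice. *)
set (phi := fun e => d x (act (gmul g t e) x) - d x (act y x)).
assert (Hwin : exists l, NoDup l /\ incl l F /\
   (forall s s', In s l -> In s' l -> phi s <= phi s' + 10 * a) /\ (S q <= length l)%nat).
{ apply NNPP. intros Hno.
  assert (length F <= 13 * q)%nat; [|lia].
  apply (window_pigeonhole phi (10 * a)).
  - lra.
  - now apply NoDup_filter.
  - intros e He. apply Hin in He. destruct He as [He [He1 He2]].
    specialize (Hrad e He). rewrite Hgp in He1. rewrite (metric_sym d delta hX (act y x) x) in He1.
    unfold phi. replace (INR 13) with 13 by (simpl; ring).
    pose proof (metric_tri d delta hX x (act y x) (act (gmul g t e) x)).
    rewrite Hdist in *. lra.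
  - intros l Hl Hi Hw. apply Nat.nlt_ge. intros Hlt. apply Hno. exists l. auto. }
destruct Hwin as [l [Hndl [Hl [Hw Hq]]]].
exists (map (gmul g t) l).
assert (Hmap : forall w, In w (map (gmul g t) l) -> exists e, w = gmul g t e /\ In e l).
{ intros w Hx. apply in_map_iff in Hx. destruct Hx as [e [<- He]]. eauto. }
repeat split.
- apply NoDup_map_on; auto. intros s s' _ _. apply gcancel_l.
- now rewrite length_map.
- destruct (Hmap w H0) as [e [-> He]]. rewrite Hdist. apply Hl, Hin in He. apply He.
- destruct (Hmap w H0) as [e [-> He]]. rewrite Hdist. apply Hl, Hin in He. now apply Hrad.
- destruct (Hmap w H0) as [e [-> He]]. apply Hl, Hin in He. destruct He as [_ [He _]].
  rewrite Hgp in He. unfold gromov_product. now rewrite Hdist.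
- intros Hne. destruct (Hmap w H0) as [e [-> He]], (Hmap w' H1) as [e' [-> He']].
  rewrite !(act_mul d g act hact), (act_isometry d g act hact).
  apply Hl, Hin in He, He'. apply Hsep; try tauto. congruence.
- destruct (Hmap w H0) as [e [-> He]], (Hmap w' H1) as [e' [-> He']].
  specialize (Hw e e' He He'). unfold phi in Hw. lra.
Qed.

Context (hent : entropy_le d act x H).

(** The tree of depth [k] has at least [q^k] distinct vertices within [121 * a * k] of [x], which
    the entropy limits. *)
Lemma branching_rate (q : nat) (child : G -> list G) :
  (0 < q)%nat ->
  (forall y, NoDup (child y) /\ (q <= length (child y))%nat /\
    (forall w, In w (child y) -> 10 * a < d (act y x) (act w x) <= 121 * a /\
       gromov_product d (act y x) x (act w x) < 4 * a) /\
    (forall w w', In w (child y) -> In w' (child y) ->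
       (w <> w' -> 20 * a < d (act w x) (act w' x)) /\
       d x (act w x) <= d x (act w' x) + 10 * a)) ->
  INR q <= exp (490 * H * a).
Proof.
intros Hq Hchild.
assert (Hq1 : 1 <= INR q) by (apply (le_INR 1); lia).
assert (Hln : 0 <= ln (INR q)) by (rewrite <- ln_1; destruct Hq1 as [Hlt|<-]; [left; apply ln_increasing|]; lra).
(* The slack in the entropy is taken to be [H], giving the rate [2 * H]. With [r >= 1220 * a],
   rounding [r / (122 * a)] down to [k] loses at most a tenth; 122 instead of 121 keeps the vertices
   strictly inside the ball. *)
destruct (hent H hH (1220 * a)) as [r [n [Hr [Hr0 [[l [Hnd [Hl Hin]]] Hn]]]]].
destruct (nat_floor (r / (122 * a))) as [k [Hk1 Hk2]].
{ apply Rlt_le, Rdiv_lt_0_compat; lra. }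
assert (Hra : r / (122 * a) * (122 * a) = r) by (field; lra).
assert (Hkr : INR k * (122 * a) <= r) by (rewrite <- Hra; apply Rmult_le_compat_r; lra).
assert (Hkr' : r - 122 * a < INR k * (122 * a)).
{ assert (r / (122 * a) * (122 * a) < (INR k + 1) * (122 * a)) by (apply Rmult_lt_compat_r; lra).
  lra. }
assert (Hk0 : 0 < INR k).
{ apply Rmult_lt_reg_r with (122 * a); lra. }
set (desc := descendants child k (gone g)).
assert (Hmany : (q ^ k <= n)%nat).
{ rewrite <- Hl.
  apply Nat.le_trans with (length desc).
  - apply descendants_many. intros y. apply Hchild.
  - apply NoDup_incl_length.
    + apply (descendants_NoDup d delta a (121 * a) hX ltac:(unfold a; lra) hdelta x
        (fun y => act y x) child); intros y; destruct (Hchild y) as [C1 [_ [C2 C3]]]; auto.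
      * intros w Hw. now apply C2.
      * intros w Hw. now apply C2.
      * intros w w' Hw Hw'. now apply C3.
      * intros w w' Hw Hw'. now apply C3.
    + intros z Hz. apply Hin.
      pose proof (descendants_dist d delta a (121 * a) hX (fun y => act y x) child) as Hd.
      specialize (Hd (fun y w Hw => proj1 (proj1 (proj2 (proj2 (Hchild y))) w Hw))).
      specialize (Hd k _ z Hz). cbv beta in Hd. rewrite (act_one d g act hact) in Hd.
      assert (0 < INR k * a) by (apply Rmult_lt_0_compat; auto). lra. }
assert (Hlnn : INR k * ln (INR q) <= ln (INR n)).
{ rewrite <- ln_pow by lra. rewrite <- pow_INR.
  apply le_INR in Hmany. rewrite pow_INR in Hmany.
  assert (0 < INR q ^ k) by (apply pow_lt; lra).
  rewrite pow_INR. destruct Hmany as [Hlt|<-]; [left; apply ln_increasing|]; lra. }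
assert (Hn' : ln (INR n) <= 2 * H * r).
{ replace (ln (INR n)) with (ln (INR n) / r * r) by (field; lra).
  apply Rmult_le_compat_r; lra. }
assert (Hfin : ln (INR q) <= 490 * H * a).
{ assert (Hkk : 1098 * r <= 1220 * (INR k * (122 * a))) by lra.
  apply Rmult_le_reg_l with (INR k); auto.
  assert (H * (1098 * r) <= H * (1220 * (INR k * (122 * a)))) by (apply Rmult_le_compat_l; lra).
  assert (0 < H * (INR k * a)) by (repeat apply Rmult_lt_0_compat; auto).
  lra. }
rewrite <- (exp_ln (INR q)) by lra.
destruct Hfin as [Hlt| ->]; [left; now apply exp_increasing|lra].
Qed.

Lemma packing_bound (E : list G) : NoDup E ->
  (forall e, In e E -> d x (act e x) <= 40 * a) ->
  (forall e e', In e E -> In e' E -> e <> e' -> 20 * a < d (act e x) (act e' x)) ->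
  INR (length E) <= 3 ^ 12 * exp (490 * H * a).
Proof.
intros Hnd HE Hsep.
assert (Hexp : 1 <= exp (490 * H * a)).
{ pose proof (exp_ineq1_le (490 * H * a)).
  assert (0 < H * a) by now apply Rmult_lt_0_compat. lra. }
destruct (Nat.le_gt_cases (length E) 8) as [Hs|Hs].
{ apply le_INR in Hs. replace (INR 8) with 8 in Hs by (simpl; ring). lra. }
(* The largest [q] with [52 * q + 8 < length E]; it yields [length E <= 52 * S q + 9], well below
   the stated constant. *)
set (q := ((length E - 9) / 52)%nat).
pose proof (Nat.div_mod_eq (length E - 9) 52) as Hdiv. fold q in Hdiv.
pose proof (Nat.mod_upper_bound (length E - 9) 52 ltac:(lia)) as Hmod.
destruct (choice_function _ (separated_children E q Hnd HE Hsep ltac:(lia))) as [child Hchild].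
assert (Hq := branching_rate (S q) child ltac:(lia) Hchild).
assert (Hle : (length E <= 52 * S q + 9)%nat) by lia.
apply le_INR in Hle. rewrite plus_INR, mult_INR in Hle.
replace (INR 52) with 52 in Hle by (rewrite INR_IZR_INZ; reflexivity).
replace (INR 9) with 9 in Hle by (rewrite INR_IZR_INZ; reflexivity).
lra.
Qed.

(** Conjugating by some [c] with [c x] near [q] brings every point back to [x], at a cost of
    [2 * (D + delta)] in displacement. *)
Lemma cocompact_uniformly_proper : proper_action d act -> uniformly_proper d act.
Proof.
intros hprop C. destruct (hprop x (C + 2 * (D + delta))) as [l Hl].
exists (length l). intros q l' Hnd Hq.
destruct (orbit_dense q) as [c Hc].
rewrite <- (length_map (fun b => gmul g (ginv g c) (gmul g b c)) l').
apply NoDup_incl_length.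
- apply NoDup_map_on; auto. intros s t _ _ E. now apply gcancel_l, gcancel_r in E.
- intros b' Hb'. apply in_map_iff in Hb'. destruct Hb' as [b [<- Hb]]. apply Hl.
  specialize (Hq b Hb).
  rewrite <- (dist_act d g act hact c (gmul g b c)), (act_mul d g act hact).
  pose proof (metric_tri d delta hX (act c x) q (act b (act c x))).
  pose proof (metric_tri d delta hX q (act b q) (act b (act c x))).
  rewrite (act_isometry d g act hact), (metric_sym d delta hX (act c x) q) in *. lra.
Qed.

End Packing.

(** * Subgroups and the theorem *)

Section Subgroup.
Context {G : Type} (g : Group G).

Lemma gen_is_subgroup (S : G -> Prop) : is_subgroup g (gen g S).
Proof.
repeat split; [apply gen_one|intros; now apply gen_mul|intros; now apply gen_inv].
Qed.

(** Integer powers are handled as fractions of natural powers, which spares sign cases in the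
    exponent laws. *)
Lemma zpow_fraction h z :
  exists n m, zpow g h z = gmul g (ginv g (gpow g h n)) (gpow g h m).
Proof.
destruct (Z_le_gt_dec 0 z) as [L|L].
- exists 0%nat, (Z.to_nat z). rewrite <- (Z2Nat.id z) at 1 by lia.
  rewrite zpow_of_nat. simpl gpow at 2. now rewrite ginv_one, gmul_1l.
- exists (Z.to_nat (- z)), 0%nat.
  replace z with (- Z.of_nat (Z.to_nat (- z)))%Z at 1 by (rewrite Z2Nat.id; lia).
  rewrite zpow_opp_of_nat. simpl gpow at 3. now rewrite gmul_1r.
Qed.

Lemma zpow_is_subgroup h : is_subgroup g (fun b => exists z, b = zpow g h z).
Proof.
repeat split.
- now exists 0%Z.
- intros x y [z ->] [w ->].
  destruct (zpow_fraction h z) as [n [m ->]], (zpow_fraction h w) as [n' [m' ->]].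
  destruct (gpow_div g h (n' + n) (m + m')) as [v Hv]. exists v. rewrite <- Hv.
  assert (Hc : gmul g (gpow g h m) (ginv g (gpow g h n'))
             = gmul g (ginv g (gpow g h n')) (gpow g h m)).
  { symmetry. apply commutes_inv. unfold commutes.
    now rewrite <- !gpow_add, Nat.add_comm. }
  rewrite !gpow_add, ginv_mul, <- !gmul_assoc. f_equal.
  now rewrite !gmul_assoc, Hc.
- intros x [z ->]. destruct (zpow_fraction h z) as [n [m ->]].
  rewrite ginv_mul, ginv_inv. destruct (gpow_div g h m n) as [v Hv]. eauto.
Qed.

Lemma zpow_mem (P : G -> Prop) h z : is_subgroup g P -> P h -> P (zpow g h z).
Proof.
intros [H1 [Hm Hi]] Hh.
assert (Hp : forall n, P (gpow g h n)) by (induction n; simpl; auto).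
destruct z; simpl; auto.
Qed.

Context (P : G -> Prop) (hP : is_subgroup g P).

Lemma sig_inj (s t : {b | P b}) : proj1_sig s = proj1_sig t -> s = t.
Proof.
destruct s as [s hs], t as [t ht]. simpl. intros ->. f_equal. apply proof_irrelevance.
Qed.

(** [N_property] speaks of whole groups, so the subgroup is made a group on a sigma type; it is
    transparent so that its operations reduce under [proj1_sig]. *)
Definition subgroup_group : Group {b | P b}.
Proof.
refine (mkGroup _
  (fun s t => exist P (gmul g (proj1_sig s) (proj1_sig t))
                (proj1 (proj2 hP) _ _ (proj2_sig s) (proj2_sig t)))
  (fun s => exist P (ginv g (proj1_sig s)) (proj2 (proj2 hP) _ (proj2_sig s)))
  (exist P (gone g) (proj1 hP)) _ _ _ _ _); intros; apply sig_inj; simpl.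
- apply gmul_assoc.
- apply gmul_1l.
- apply gmul_1r.
- apply gmul_Vl.
- apply gmul_Vr.
Defined.

Lemma val_zpow c z :
  proj1_sig (zpow subgroup_group c z) = zpow g (proj1_sig c) z.
Proof.
assert (Hp : forall n, proj1_sig (gpow subgroup_group c n) = gpow g (proj1_sig c) n)
  by (induction n as [|n IH]; simpl; now rewrite <- ?IH).
destruct z; simpl; rewrite ?Hp; auto.
Qed.

Lemma cyclic_cover_virtually_cyclic :
  cyclic_cover subgroup_group (fun _ => True) -> virtually_cyclic_sub g P.
Proof.
intros [c [l Hl]]. exists (fun b => exists z, b = zpow g (proj1_sig c) z).
split; [apply zpow_is_subgroup|split; [|split]].
- intros b [z ->]. apply zpow_mem; auto. apply proj2_sig.
- exists (map (@proj1_sig _ _) l). intros b Hb.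
  destruct (Hl (exist P b Hb) I) as [e [z [He E]]]. exists (proj1_sig e). split.
  + now apply in_map.
  + exists z. apply (f_equal (@proj1_sig _ _)) in E. simpl in E.
    now rewrite E, val_zpow, gmulKl.
- exists (proj1_sig c). intros b. reflexivity.
Qed.

End Subgroup.

Lemma gen_sigma_generates {G} (g : Group G) (S : G -> Prop)
  (L : list {b | gen g S b}) :
  (forall t, S (proj1_sig t) -> In t L) ->
  generating_set (subgroup_group g (gen g S) (gen_is_subgroup g S)) L.
Proof.
intros HL. set (sg := subgroup_group g (gen g S) (gen_is_subgroup g S)).
(* Quantifying over [hb] allows any membership proof; two of them give equal elements by
   [sig_inj]. *)
assert (H : forall b, gen g S b -> forall hb, gen sg (fun s => In s L) (exist _ b hb)).
{ induction 1 as [b Hb| |b c Hb IHb Hc IHc|b Hb IHb]; intros hb.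
  - apply gen_in. now apply HL.
  - rewrite (sig_inj _ (exist _ _ hb) (gone sg) eq_refl). apply gen_one.
  - rewrite (sig_inj _ (exist _ _ hb) (gmul sg (exist _ b Hb) (exist _ c Hc)) eq_refl).
    now apply gen_mul.
  - rewrite (sig_inj _ (exist _ _ hb) (ginv sg (exist _ b Hb)) eq_refl).
    now apply gen_inv. }
intros [b hb]. now apply H.
Qed.

(* A maximal [r]-separated subset of [A A] gives translates of [A] covering [A A]. *)
Lemma product_set_covering {X G} (d : X -> X -> R) (delta : R) (g : Group G)
  (act : G -> X -> X) (x : X) (r : R) (p : nat) (A lAA : list G) :
  hyperbolic_space d delta -> isometric_action d g act -> NoDup lAA -> 0 <= r ->
  (forall a, In a A <-> d x (act a x) <= r) ->
  (forall z, In z lAA -> exists a b, In a A /\ In b A /\ z = gmul g a b) ->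
  (forall E, NoDup E -> (forall e, In e E -> d x (act e x) <= 2 * r) ->
     (forall e e', In e E -> In e' E -> e <> e' -> r < d (act e x) (act e' x)) ->
     (length E <= p)%nat) ->
  (length lAA <= p * length A)%nat.
Proof.
intros hX hact Hnd Hr HA HAA Hpack.
destruct (exists_longest (fun E => NoDup E /\ incl E lAA /\
   forall e e', In e E -> In e' E -> e <> e' -> r < d (act e x) (act e' x)) (length lAA))
  as [E [[HndE [HE Hsep]] Hmax]].
{ exists nil. repeat split; [constructor|intros e []|intros e e' []]. }
{ intros E [H1 [H2 _]]. now apply NoDup_incl_length. }
apply Nat.le_trans with (length E * length A)%nat.
- rewrite <- (length_flat_map_const (fun e => map (gmul g e) A));
    [|intros; apply length_map].
  apply NoDup_incl_length; auto. intros z Hz. apply in_flat_map.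
  assert (Hnear : exists e, In e E /\ d (act e x) (act z x) <= r).
  { apply NNPP. intros Hno.
    assert (Hfar : forall e, In e E -> r < d (act e x) (act z x)).
    { intros e He. apply Rnot_le_lt. intros Hle. apply Hno; eauto. }
    specialize (Hmax (z :: E)). simpl in Hmax.
    assert (S (length E) <= length E)%nat; [apply Hmax|lia].
    repeat split.
    - constructor; auto. intros Hin. specialize (Hfar z Hin).
      rewrite (metric_self d delta hX) in Hfar. lra.
    - intros e [<-|He]; auto.
    - intros e e' [<-|He] [<-|He'] Hne; auto; [easy|].
      rewrite (metric_sym d delta hX). auto. }
  destruct Hnear as [e [He Hd]]. exists e. split; auto.
  apply in_map_iff. exists (gmul g (ginv g e) z). split; [apply gmulKlV|].
  apply HA. now rewrite <- (dist_act d g act hact).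
- apply Nat.mul_le_mono_r. apply Hpack; auto. intros e He.
  destruct (HAA e (HE e He)) as [a [b [Ha [Hb ->]]]]. apply HA in Ha, Hb.
  pose proof (displacement_mul d delta hX g act hact a b x). lra.
Qed.

Lemma displacement_prod_list {X G} (d : X -> X -> R) (delta : R) (g : Group G)
  (act : G -> X -> X) (x : X) (r : R) (l : list G) :
  hyperbolic_space d delta -> isometric_action d g act ->
  (forall s, In s l -> d x (act s x) <= r) ->
  d x (act (prod_list g l) x) <= INR (length l) * r.
Proof.
intros hX hact. induction l as [|s l IH]; intros Hl.
- simpl. rewrite (act_one d g act hact), (metric_self d delta hX). lra.
- rewrite length_cons, S_INR. simpl prod_list.
  pose proof (displacement_mul d delta hX g act hact s (prod_list g l) x).
  pose proof (Hl s (or_introl eq_refl)).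
  assert (d x (act (prod_list g l) x) <= INR (length l) * r)
    by (apply IH; intros; apply Hl; simpl; auto).
  lra.
Qed.

Lemma nat_le_succ_Int_part (n : nat) (K : R) :
  INR n <= K -> (n <= S (Z.to_nat (Int_part K)))%nat.
Proof.
intros Hn. destruct (base_Int_part K) as [_ HK]. rewrite INR_IZR_INZ in Hn.
assert (Z.of_nat n < Int_part K + 1)%Z; [|lia].
apply lt_IZR. rewrite plus_IZR. lra.
Qed.

Theorem theorem5p12 (N : nat -> nat)
  (hNpos : forall p, (0 < p)%nat -> (0 < N p)%nat)
  (hN : N_property N)
  (delta H D : R) (hdelta : 0 < delta) (hH : 0 < H) (hD : 0 < D)
  (X : Type) (d : X -> X -> R) (hX : hyperbolic_space d delta)
  (Gam : Type) (g : Group Gam) (act : Gam -> X -> X)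
  (hact : isometric_action d g act) (hprop : proper_action d act)
  (hdiam : quotient_diam_le d act D)
  (hent : forall x0, entropy_le d act x0 H) :
  forall (x : X) (rho : R), rho <= eps0 N delta H D ->
    virtually_cyclic_sub g (Gamma_rho d g act rho x).
Proof.
intros x rho Hrho.
set (hP := gen_is_subgroup g (Sigma d g act rho x)).
set (sg := subgroup_group g _ hP).
set (sact := fun (t : {b | Gamma_rho d g act rho x b}) => act (proj1_sig t)).
assert (Hsact : isometric_action d sg sact).
{ repeat split; intros; apply hact. }
assert (HsUP : uniformly_proper d sact).
{ intros C.
  destruct (cocompact_uniformly_proper d delta D hX hdelta g act hact hdiam x hprop C)
    as [B HB].
  exists B. intros q l Hnd Hl. rewrite <- (length_map (@proj1_sig _ _)).
  apply (HB q).
  - apply NoDup_map_on; auto. intros s t _ _. apply sig_inj.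
  - intros b Hb. apply in_map_iff in Hb. destruct Hb as [t [<- Ht]]. now apply Hl. }
assert (Hfin : forall r, exists l, NoDup l /\ forall t, In t l <-> d x (sact t x) <= r).
{ intros r. destruct (hprop x r) as [l Hl].
  apply (finite_preimage (@proj1_sig _ _) l); [intros; now apply sig_inj|].
  intros t. apply Hl. }
apply (cyclic_cover_virtually_cyclic g _ hP).
apply (virtually_nilpotent_cyclic_cover d delta hX hdelta sg sact Hsact HsUP x).
set (K := 3 ^ 12 * exp (490 * H * (D + 2 * delta))).
set (p := S (Z.to_nat (Int_part K))).
assert (Hp : (0 < p)%nat) by (unfold p; lia).
set (R0 := R0c delta D).
assert (HR0 : 0 < R0) by (unfold R0, R0c; lra).
destruct (Hfin R0) as [A [HndA HA]].
destruct (hprop x rho) as [lrho Hlrho].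
destruct (finite_preimage (@proj1_sig _ (Gamma_rho d g act rho x)) lrho
  (fun s t => sig_inj _ s t) (fun t => Sigma d g act rho x (proj1_sig t)))
  as [L [_ HL]].
{ intros t [_ Ht]. now apply Hlrho. }
destruct (finite_subset (flat_map (fun a => map (gmul sg a) A) A)
  (fun z => exists a b, In a A /\ In b A /\ z = gmul sg a b)) as [lAA [HndAA HAA]].
{ intros z [a [b [Ha [Hb ->]]]]. apply in_flat_map. exists a. split; auto.
  now apply in_map. }
(* [L] enumerates the generators inside the subgroup, and [A] its elements of displacement at most
   [R0]. *)
apply (hN p Hp _ sg L).
- intros s Hs. rewrite HL in *. destruct Hs as [Hs1 Hs2]. split; simpl.
  + intros E. apply Hs1.
    exact (eq_trans (eq_sym (ginv_inv g _)) (eq_trans (f_equal (ginv g) E) (ginv_one g))).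
  + rewrite (displacement_inv d delta hX g act hact). exact Hs2.
- apply gen_sigma_generates. intros t. apply HL.
- exists A, (length lAA). split; [auto|split; [|split]].
  (* A product of [N p] generators moves [x] by at most [N p * rho <= R0]; this is what the choice
     of [eps0] is for. *)
  + intros t [l [Hlen [Hl ->]]]. apply HA.
    pose proof (displacement_prod_list d delta sg sact x rho l hX Hsact) as Hd.
    rewrite Hlen in Hd.
    assert (HNp : 0 < INR (N p)) by (apply lt_0_INR; auto).
    assert (INR (N p) * rho <= R0).
    { apply Rmult_le_compat_l with (r := INR (N p)) in Hrho; [|lra].
      replace (INR (N p) * eps0 N delta H D) with R0 in Hrho; auto.
      unfold eps0, N0c. fold K p R0. field. lra. }
    apply Rle_trans with (INR (N p) * rho); auto. apply Hd.
    intros s Hs. apply Hl, HL in Hs. apply Hs.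
  + exists lAA. auto.
  (* Since [R0 = 20 * (D + 2 * delta)], separation [R0] and radius [2 * R0] are those of the packing
     bound, whose constant is turned into the integer [p]. *)
  + apply (product_set_covering d delta sg sact x R0); auto; [lra|intros z; apply HAA|].
    intros E HndE HE Hsep. apply nat_le_succ_Int_part. fold K.
    rewrite <- (length_map (@proj1_sig _ _) E). unfold R0, R0c in *.
    apply (packing_bound d delta D H hX hdelta hD hH g act hact hdiam x (hent x)).
    * apply NoDup_map_on; auto. intros s t _ _. apply sig_inj.
    * intros b Hb. apply in_map_iff in Hb. destruct Hb as [t [<- Ht]].
      eapply Rle_trans; [exact (HE t Ht)|lra].
    * intros b b' Hb Hb' Hne. apply in_map_iff in Hb, Hb'.
      destruct Hb as [t [<- Ht]], Hb' as [t' [<- Ht']]. apply Hsep; auto. congruence.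
Qed.
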